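(* Let $\Lambda$ be a set of exponents, let $\mathcal{G}$ be an equivalence class in $\mathcal{F}_{\Lambda}$ with respect to the relation $\overset{*}{\sim}$, and let $f\in\mathcal{G}$. Then, in the topology of uniform convergence on $\mathbb{R}$, the set of functions $\mathcal{T}_f=\{f_{\tau}(t):=f(t+\tau):\tau\in\mathbb{R}\}$ is dense in $\mathcal{G}$.
   Context: A set of exponents is a countable set $\Lambda=\{\lambda_1,\lambda_2,\ldots\}$ of distinct real numbers. $AP(\mathbb{R},\mathbb{C})$ is the space of (Bohr, i.e. uniformly) almost periodic functions: continuous $f:\mathbb{R}\to\mathbb{C}$ such that for every $\varepsilon>0$ there is $l>0$ such that every interval of length $l$ contains a $\tau$ with $|f(t+\tau)-f(t)|\le\varepsilon$ for all $t\in\mathbb{R}$. Its Fourier coefficients are $a(f,\lambda)=\lim_{l\to\infty}\frac{1}{2l}\int_{-l}^{l}f(t)e^{-i\lambda t}\,dt$, $\lambda\in\mathbb{R}$. $\mathcal{F}_{\Lambda}$ is the set of $f\in AP(\mathbb{R},\mathbb{C})$ whose Fourier series has the form $\sum_{j\ge1}a_je^{i\lambda_jt}$ with $a_j\in\mathbb{C}$, $\lambda_j\in\Lambda$. Equivalence: two functions in $\mathcal{F}_{\Lambda}$ with Fourier series $\sum_{j\ge1}a_je^{i\lambda_jt}$ and $\sum_{j\ge1}b_je^{i\lambda_jt}$ are equivalent (written $\overset{*}{\sim}$) if for each integer $n$ with $1\le n\le\sharp\Lambda$ there exists a $\mathbb{Q}$-linear map $\psi_n:V_n\to\mathbb{R}$,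 where $V_n\subset\mathbb{R}$ is the $\mathbb{Q}$-vector space generated by $\{\lambda_1,\ldots,\lambda_n\}$, such that $b_j=a_je^{i\psi_n(\lambda_j)}$ for $j=1,\ldots,n$. *)

(* Defs.v *)
From Stdlib Require Import Reals QArith Qreals.
From Coquelicot Require Import Coquelicot.
Open Scope R_scope.

(** Stdlib reals with Coquelicot. [C_R_CompleteNormedModule] is [C] seen as a
    Banach space over [R]; it has to be given by hand to [RInt]. *)

Definition Cexpi (x : R) : C := (cos x, sin x).

(** ** Almost periodic functions *)

Definition almost_periodic (f : R -> C) : Prop :=
  (forall t : R, continuous f t) /\
  forall eps : R, 0 < eps ->
    exists l : R, 0 < l /\
      forall a : R, exists tau : R,
        a <= tau <= a + l /\
        forall t : R, Cmod (f (t + tau)%R - f t) <= eps.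

Definition fourier_mean (f : R -> C) (lam l : R) : C :=
  (RtoC (/ (2 * l)) *
   RInt (V := C_R_CompleteNormedModule)
        (fun t : R => (f t * Cexpi (- (lam * t)))%C) (- l) l)%C.

(** The limit of [fourier_mean f lam l] as [l] tends to infinity. As in the
    library's definition of [RInt], [iota] makes the limit a total function,
    whose value is meaningful when the limit exists. *)
Definition fourier_coeff (f : R -> C) (lam : R) : C :=
  iota (T := C_R_CompleteNormedModule)
    (fun a : C =>
       filterlim (fourier_mean f lam) (Rbar_locally p_infty)
                 (locally (T := C_R_CompleteNormedModule) a)).

(** ** Sets of exponents *)

(** A countable set {lambda_1, lambda_2, ...} given with its enumeration, which
    starts at index 1. The cardinal is [Some N] for a set with [N] elements and
    [None] for an infinite one; the values of [expo] at index 0 and beyond the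
    cardinal are irrelevant. *)
Definition index_in (card : option nat) (j : nat) : Prop :=
  (1 <= j)%nat /\ match card with Some N => (j <= N)%nat | None => True end.

Record exponents := Exponents {
  expo_card : option nat;
  expo : nat -> R;
  expo_inj : forall i j : nat,
    index_in expo_card i -> index_in expo_card j -> expo i = expo j -> i = j
}.

Definition in_exponents (L : exponents) (x : R) : Prop :=
  exists j : nat, index_in (expo_card L) j /\ x = expo L j.

Definition F_class (L : exponents) (f : R -> C) : Prop :=
  almost_periodic f /\
  forall lam : R, ~ in_exponents L lam -> fourier_coeff f lam = RtoC 0.

(** ** Equivalence *)

Definition Qspan (L : exponents) (n : nat) (x : R) : Prop :=
  exists q : nat -> Q, x = sum_n_m (fun j : nat => Q2R (q j) * expo L j) 1 n.

(** A map defined on [V] is represented by a function on [R] whose values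
    outside [V] play no role. *)
Definition Qlinear_on (V : R -> Prop) (psi : R -> R) : Prop :=
  (forall x y : R, V x -> V y -> psi (x + y) = psi x + psi y) /\
  (forall (q : Q) (x : R), V x -> psi (Q2R q * x) = Q2R q * psi x).

Definition ap_equiv (L : exponents) (f g : R -> C) : Prop :=
  forall n : nat, index_in (expo_card L) n ->
    exists psi : R -> R,
      Qlinear_on (Qspan L n) psi /\
      forall j : nat, (1 <= j <= n)%nat ->
        fourier_coeff g (expo L j) =
        (fourier_coeff f (expo L j) * Cexpi (psi (expo L j)))%C.

Definition ap_equiv_class (L : exponents) (G : (R -> C) -> Prop) : Prop :=
  exists h : R -> C, F_class L h /\
    forall g : R -> C, G g <-> F_class L g /\ ap_equiv L h g.

(** ** Density *)

Definition translates (f : R -> C) (g : R -> C) : Prop :=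
  exists tau : R, g = (fun t : R => f (t + tau)).

(** [A] is a subset of [B] whose closure contains [B]. The uniform structure of
    [fct_UniformSpace R C_UniformSpace] is that of uniform convergence on [R]:
    [g] is in the ball of radius [eps] around [f] when each [g t] is in the
    ball of radius [eps] around [f t]. *)
Definition uniformly_dense_in (A B : (R -> C) -> Prop) : Prop :=
  (forall g : R -> C, A g -> B g) /\
  (forall g : R -> C, B g ->
     forall U : (R -> C) -> Prop,
       locally (T := fct_UniformSpace R C_UniformSpace) g U ->
       exists h : R -> C, A h /\ U h).

(* Main.v *)
Require Import Defs.
From Stdlib Require Import Reals Lra Lia List ClassicalEpsilon ZArith.
From Stdlib Require Import QArith Qreals.
From Coquelicot Require Import Coquelicot.
Import ListNotations.
Open Scope R_scope.

(** Equivalent functions [f] and [g] are both approximated uniformly by finite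
    sums [sum_i c_i a(f, mu_i) e^(i mu_i t)] and
    [sum_i c_i a(g, mu_i) e^(i mu_i t)] with the same real factors [c_i] and the
    same frequencies [mu_i] ([fourier_approximation]). Only finitely many
    exponents [lambda_j] occur among the [mu_i], and for these
    [a(g, lambda_j) = a(f, lambda_j) e^(i psi(lambda_j))] with one rational-linear
    map [psi]. Kronecker's theorem ([kronecker]) gives [tau] for which every
    [e^(i lambda_j tau)] is close to [e^(i psi(lambda_j))]; for this [tau] the two
    sums, the first one translated by [tau], are close to each other, hence so
    are [f (t + tau)] and [g t]. Conversely a translation multiplies
    [a(f, lambda)] by [e^(i lambda tau)], so it stays in the class.

    The approximation rests on Bogolyubov's description of almost periods: the
    almost periods of [f] contain a Bohr set, the set of all [tau] such that
    [cos (lam tau) > 1 - del] for finitely many [lam]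
    ([almost_periods_contain_bohr_set]). It comes from a counting argument in
    finite cyclic groups ([finite_bogolyubov]) followed by a passage to the limit
    ([bogolyubov]). Given a Bohr set, let [K] be the product of the
    [((1 + cos (lam s)) / 2) ^ m]. It is a trigonometric polynomial whose Fourier
    coefficients are nonnegative, and its mean decreases only polynomially in [m]
    ([kernel_expansion]), whereas off the Bohr set [K] is exponentially small. So
    the convolution of [f] with [K], divided by the mean of [K], is close to [f],
    and it is a finite sum of the required form. Taking one Bohr set of almost
    periods of both functions makes the factors common to [f] and [g]. The
    convolution over a long interval approximates [f] before any mean is known to
    exist; the existence of the Fourier coefficients is deduced from this
    ([fourier_mean_converges]).

    The same kernel, with the phases [psi lam] inserted, proves Kronecker's
    theorem. The linearity of [psi] makes all phases of the constant term vanish,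
    so the mean is still only polynomially small, while it would be exponentially
    small if every [s] missed the target for some [lam]. *)

(** * Finite sums over lists *)

Definition Rsum {A : Type} (F : A -> R) (l : list A) : R :=
  fold_right (fun a s => F a + s) 0 l.

Lemma Rsum_ext {A : Type} (F G : A -> R) l :
  (forall a, In a l -> F a = G a) -> Rsum F l = Rsum G l.
Proof.
  induction l as [|a l IH]; simpl; intros H; [reflexivity|].
  rewrite H, IH; auto.
Qed.

Lemma Rsum_le {A : Type} (F G : A -> R) l :
  (forall a, In a l -> F a <= G a) -> Rsum F l <= Rsum G l.
Proof.
  induction l as [|a l IH]; simpl; intros H; [lra|].
  apply Rplus_le_compat; auto.
Qed.

Lemma Rsum_plus {A : Type} (F G : A -> R) l :
  Rsum (fun a => F a + G a) l = Rsum F l + Rsum G l.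
Proof. induction l as [|a l IH]; simpl; [lra|]. rewrite IH; ring. Qed.

Lemma Rsum_scal {A : Type} (c : R) (F : A -> R) l :
  Rsum (fun a => c * F a) l = c * Rsum F l.
Proof. induction l as [|a l IH]; simpl; [lra|]. rewrite IH; ring. Qed.

Lemma Rsum_const {A : Type} (c : R) (l : list A) :
  Rsum (fun _ => c) l = c * INR (length l).
Proof.
  induction l as [|a l IH]; simpl Rsum; [simpl; lra|].
  rewrite IH. simpl length. rewrite S_INR. ring.
Qed.

Lemma Rsum_nonneg {A : Type} (F : A -> R) l :
  (forall a, In a l -> 0 <= F a) -> 0 <= Rsum F l.
Proof.
  intros H. replace 0 with (Rsum (fun _ : A => 0) l).
  - now apply Rsum_le.
  - rewrite Rsum_const; ring.
Qed.

Lemma Rsum_ge_term {A : Type} (F : A -> R) a l :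
  (forall b, In b l -> 0 <= F b) -> In a l -> F a <= Rsum F l.
Proof.
  intros H Hin. induction l as [|b l IH]; [contradiction|]. simpl.
  assert (0 <= F b) by (apply H; now left).
  assert (0 <= Rsum F l) by (apply Rsum_nonneg; intros; apply H; now right).
  destruct Hin as [->|Hin]; [lra|].
  assert (F a <= Rsum F l) by (apply IH; [intros; apply H; now right|exact Hin]).
  lra.
Qed.

Lemma Rsum_app {A : Type} (F : A -> R) l1 l2 :
  Rsum F (l1 ++ l2) = Rsum F l1 + Rsum F l2.
Proof. induction l1 as [|a l IH]; simpl; [lra|]. rewrite IH; ring. Qed.

Lemma Rsum_map {A B : Type} (h : A -> B) (F : B -> R) l :
  Rsum F (map h l) = Rsum (fun a => F (h a)) l.
Proof. induction l as [|a l IH]; simpl; [reflexivity|]. now rewrite IH. Qed.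

Lemma Rsum_swap {A B : Type} (F : A -> B -> R) l1 l2 :
  Rsum (fun a => Rsum (fun b => F a b) l2) l1 =
  Rsum (fun b => Rsum (fun a => F a b) l1) l2.
Proof.
  induction l1 as [|a l IH]; simpl.
  - rewrite Rsum_const; ring.
  - now rewrite IH, <- Rsum_plus.
Qed.

Lemma Rsum_indicator {A : Type} (dec : forall a b : A, {a = b} + {a <> b})
    (c : R) a l :
  NoDup l -> 0 <= c -> Rsum (fun b => if dec a b then c else 0) l <= c.
Proof.
  intros Hl Hc. induction Hl as [|b l Hb Hl IH]; simpl; [exact Hc|].
  destruct (dec a b) as [->|_]; [|lra].
  rewrite (Rsum_ext _ (fun _ => 0)), Rsum_const; [lra|].
  intros x Hx. destruct (dec b x) as [->|_]; [contradiction|reflexivity].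
Qed.

(** * Bogolyubov's theorem on the integers *)

(** The squared modulus of the Fourier transform of the set of the [s i],
    [i < m], at frequency [y]. *)
Definition power (s : nat -> Z) (m : nat) (y : R) : R :=
  (Rsum (fun i => cos (y * IZR (s i))) (seq 0 m)) ^ 2 +
  (Rsum (fun i => sin (y * IZR (s i))) (seq 0 m)) ^ 2.

Definition grid (N x : nat) : R := 2 * PI * INR x / INR N.

Lemma power_nonneg s m y : 0 <= power s m y.
Proof. unfold power; apply Rplus_le_le_0_compat; apply pow2_ge_0. Qed.

Lemma power_0 s m : power s m 0 = INR m ^ 2.
Proof.
  unfold power.
  rewrite (Rsum_ext _ (fun _ => 1)), (Rsum_ext (fun i => sin _) (fun _ => 0)).
  - rewrite !Rsum_const, length_seq. ring.
  - intros i _. now rewrite Rmult_0_l, sin_0.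
  - intros i _. now rewrite Rmult_0_l, cos_0.
Qed.

(** In the expansion of the cosine the terms with the factor
    [sin (y (s i - s j))] cancel by exchanging [i] and [j]. *)
Lemma sum_cos_pairs s m y z :
  Rsum (fun i => Rsum (fun j => cos (y * (IZR (s i) - IZR (s j)) + z))
    (seq 0 m)) (seq 0 m) = power s m y * cos z.
Proof.
  set (C := fun i => cos (y * IZR (s i))).
  set (S := fun i => sin (y * IZR (s i))).
  rewrite (Rsum_ext _ (fun i =>
    (Rsum C (seq 0 m) * cos z + Rsum S (seq 0 m) * sin z) * C i +
    (Rsum S (seq 0 m) * cos z - Rsum C (seq 0 m) * sin z) * S i)).
  - rewrite Rsum_plus, !Rsum_scal. unfold power. fold C S. ring.
  - intros i _.
    rewrite (Rsum_ext _ (fun j =>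
      (C i * cos z - S i * sin z) * C j + (S i * cos z + C i * sin z) * S j)).
    + rewrite Rsum_plus, !Rsum_scal. ring.
    + intros j _. unfold C, S.
      replace (y * (IZR (s i) - IZR (s j)) + z)
        with (y * IZR (s i) - y * IZR (s j) + z) by ring.
      rewrite cos_plus, cos_minus, sin_minus. ring.
Qed.

(** [sum_cos_pairs], applied to the pairs [(i, j)] and then to the pairs
    [(p, q)]. Summed over a grid of frequencies [y], the left side counts the
    representations of [- k]. *)
Lemma sum_cos_quadruples s m y k :
  Rsum (fun p => Rsum (fun q => Rsum (fun i => Rsum (fun j =>
    cos (y * IZR (s i - s j + (s p - s q) + k)))
    (seq 0 m)) (seq 0 m)) (seq 0 m)) (seq 0 m) =
  power s m y ^ 2 * cos (y * IZR k).
Proof.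
  replace (power s m y ^ 2 * cos (y * IZR k))
    with (power s m y * (power s m y * cos (y * IZR k))) by ring.
  rewrite <- (sum_cos_pairs s m y (y * IZR k)), <- Rsum_scal.
  apply Rsum_ext; intros p _. rewrite <- Rsum_scal.
  apply Rsum_ext; intros q _. rewrite <- sum_cos_pairs.
  apply Rsum_ext; intros i _. apply Rsum_ext; intros j _.
  f_equal. rewrite !plus_IZR, !minus_IZR. ring.
Qed.

(** Multiplying by [2 sin (y/2)] makes the sum of cosines telescope. *)
Lemma sum_cos_telescope y N :
  2 * sin (y / 2) * Rsum (fun x => cos (INR x * y)) (seq 0 N) =
  sin (INR N * y - y / 2) + sin (y / 2).
Proof.
  induction N as [|N IH].
  - simpl. replace (0 * y - y / 2) with (- (y / 2)) by ring.
    rewrite sin_neg. ring.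
  - rewrite seq_S, Rsum_app, Rmult_plus_distr_l, IH. simpl Rsum.
    rewrite S_INR. simpl plus.
    replace ((INR N + 1) * y - y / 2) with (INR N * y + y / 2) by field.
    rewrite sin_plus, sin_minus. ring.
Qed.

(** The values [exp (2 i PI x k / N)], [x < N], are equidistributed on a
    nontrivial group of roots of unity. *)
Lemma sum_cos_grid N (k : Z) :
  (Z.abs k < Z.of_nat N)%Z -> (k <> 0)%Z ->
  Rsum (fun x => cos (grid N x * IZR k)) (seq 0 N) = 0.
Proof.
  intros HkN Hk.
  assert (HN : 0 < INR N) by (apply lt_0_INR; lia).
  pose proof PI_RGT_0 as Hpi.
  set (y := 2 * PI * IZR k / INR N).
  rewrite (Rsum_ext _ (fun x => cos (INR x * y))).
  2:{ intros x _. f_equal. unfold grid, y. field. lra. }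
  assert (Hs : sin (y / 2) <> 0).
  { intros H. apply sin_eq_0_0 in H as [c Hc].
    assert (E : IZR k = IZR c * IZR (Z.of_nat N)).
    { rewrite <- INR_IZR_INZ.
      apply (Rmult_eq_reg_r (PI / INR N)).
      2:{ apply Rgt_not_eq. apply Rdiv_lt_0_compat; lra. }
      transitivity (y / 2); [unfold y; field; lra|].
      rewrite Hc. field. lra. }
    rewrite <- mult_IZR in E. apply eq_IZR in E.
    assert (c <> 0)%Z by (intros ->; lia).
    subst k. rewrite Z.abs_mul in HkN. nia. }
  assert (T := sum_cos_telescope y N).
  replace (INR N * y - y / 2) with (- (y / 2) + 2 * IZR k * PI) in T
    by (unfold y; field; lra).
  assert (P : sin (- (y / 2) + 2 * IZR k * PI) = - sin (y / 2)).
  { rewrite <- sin_neg. destruct k as [|p|p]; [lia| |].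
    - replace (IZR (Z.pos p)) with (INR (Pos.to_nat p)).
      + apply sin_period.
      + rewrite INR_IZR_INZ. f_equal. lia.
    - rewrite <- (sin_period _ (Pos.to_nat p)). f_equal.
      rewrite INR_IZR_INZ.
      replace (Z.neg p) with (- Z.of_nat (Pos.to_nat p))%Z by lia.
      rewrite opp_IZR. ring. }
  rewrite P in T.
  apply (Rmult_eq_reg_l (2 * sin (y / 2))); [lra|].
  apply Rmult_integral_contrapositive_currified; lra.
Qed.

Section FiniteBogolyubov.

Variables (s : nat -> Z) (L m : nat).
Hypothesis HL : (0 < L)%nat.
Hypothesis Hm : (0 < m)%nat.
Hypothesis Hs : forall i,
  (Z.of_nat (i * L) <= s i < Z.of_nat (i * L + L))%Z.

(** Four times the length of the interval that contains the [s i], [i < m]: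
    sums of four of these and a number [k] below that length do not wrap
    around. *)
Let N := (4 * (m * L))%nat.

Lemma s_range i : In i (seq 0 m) -> (0 <= s i < Z.of_nat (m * L))%Z.
Proof.
  intros Hi. apply in_seq in Hi. specialize (Hs i).
  assert (i * L + L <= m * L)%nat by nia. lia.
Qed.

Lemma s_inj i j : s i = s j -> i = j.
Proof.
  intros E. assert (Hi := Hs i). assert (Hj := Hs j). rewrite E in Hi.
  destruct (Nat.lt_trichotomy i j) as [H|[H|H]]; [|exact H|];
    exfalso; nia.
Qed.

(** Parseval's identity: only the [m] diagonal pairs survive the sum over the
    grid. *)
Lemma sum_power_grid :
  Rsum (fun x => power s m (grid N x)) (seq 0 N) <= INR N * INR m.
Proof.
  rewrite (Rsum_ext _ (fun x => Rsum (fun i => Rsum (fun j =>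
    cos (grid N x * IZR (s i - s j))) (seq 0 m)) (seq 0 m))).
  2:{ intros x _. rewrite <- (Rmult_1_r (power _ _ _)), <- cos_0,
        <- sum_cos_pairs.
      apply Rsum_ext; intros i _. apply Rsum_ext; intros j _.
      f_equal. rewrite minus_IZR. ring. }
  rewrite Rsum_swap.
  replace (INR N * INR m) with (Rsum (fun _ => INR N) (seq 0 m))
    by now rewrite Rsum_const, length_seq.
  apply Rsum_le; intros i Hi. rewrite Rsum_swap.
  rewrite (Rsum_ext _ (fun j => if Nat.eq_dec i j then INR N else 0)).
  - apply Rsum_indicator; [apply seq_NoDup|apply pos_INR].
  - intros j Hj. destruct (Nat.eq_dec i j) as [<-|Hij].
    + rewrite (Rsum_ext _ (fun _ => 1)), Rsum_const, length_seq; [ring|].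
      intros x _. rewrite Z.sub_diag, Rmult_0_r. apply cos_0.
    + apply sum_cos_grid.
      * apply s_range in Hi, Hj. unfold N. lia.
      * intros E. apply Hij, s_inj. lia.
Qed.

(** Coefficients below this threshold contribute at most
    [theta * (N * m) = m ^ 4 / 2] to the sum of the [power ^ 2], half of what
    frequency [0] contributes. *)
Let theta := INR m ^ 2 / (8 * INR L).

Definition large_spectrum : list nat :=
  filter (fun x => if Rle_dec (power s m (grid N x)) theta then false else true)
    (seq 0 N).

Lemma large_spectrum_In x :
  In x large_spectrum <-> In x (seq 0 N) /\ theta < power s m (grid N x).
Proof.
  unfold large_spectrum. rewrite filter_In.
  destruct (Rle_dec (power s m (grid N x)) theta); split; intros [H1 H2];
    split; try discriminate; auto; lra.
Qed.

Lemma INR_L_ge_1 : 1 <= INR L.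
Proof. change 1 with (INR 1). apply le_INR. lia. Qed.
Lemma INR_m_ge_1 : 1 <= INR m.
Proof. change 1 with (INR 1). apply le_INR. lia. Qed.

Lemma theta_pos : 0 < theta.
Proof.
  pose proof INR_L_ge_1. pose proof INR_m_ge_1. unfold theta.
  apply Rdiv_lt_0_compat; [apply pow_lt|]; lra.
Qed.

Lemma INR_N : INR N = 4 * (INR m * INR L).
Proof. unfold N. rewrite !mult_INR. simpl. ring. Qed.

(** The total power [N * m] leaves no room for more coefficients above [theta].
    That the bound is the same for all [m] makes the limit in [bogolyubov]
    possible. *)
Lemma large_spectrum_length : (length large_spectrum <= 32 * (L * L))%nat.
Proof.
  pose proof theta_pos as Ht. pose proof INR_L_ge_1 as HL1.
  pose proof INR_m_ge_1 as Hm1.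
  apply INR_le. apply (Rmult_le_reg_l theta); [exact Ht|].
  rewrite <- Rsum_const.
  apply Rle_trans with (INR N * INR m).
  - apply Rle_trans with (2 := sum_power_grid).
    unfold large_spectrum. induction (seq 0 N) as [|x l IH]; simpl; [lra|].
    pose proof (power_nonneg s m (grid N x)).
    destruct (Rle_dec _ _); simpl; lra.
  - apply Req_le. rewrite INR_N, !mult_INR. unfold theta.
    replace (INR 32) with 32 by (simpl; ring). field. lra.
Qed.

(** If no quadruple represented [k], the sum over the grid of
    [power ^ 2 * cos] would vanish. But frequency [0] contributes [m ^ 4],
    the rest of the large spectrum is nonnegative by hypothesis and the small
    coefficients are controlled by Parseval's identity. *)
Lemma finite_bogolyubov k :
  (Z.abs k < Z.of_nat (m * L))%Z ->
  (forall x, In x large_spectrum -> 0 <= cos (grid N x * IZR k)) ->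
  exists i j p q, (s i - s j + (s p - s q) + k = 0)%Z.
Proof.
  intros Hk Hcos.
  destruct (classic (exists i j p q, (s i - s j + (s p - s q) + k = 0)%Z))
    as [H|Hno]; [exact H|exfalso].
  pose proof theta_pos as Ht. pose proof INR_L_ge_1 as HL1.
  pose proof INR_m_ge_1 as Hm1.
  assert (Hz : Rsum (fun x => power s m (grid N x) ^ 2 *
                               cos (grid N x * IZR k)) (seq 0 N) = 0).
  { rewrite (Rsum_ext _ _ _ (fun x _ => eq_sym
      (sum_cos_quadruples s m (grid N x) k))).
    rewrite Rsum_swap, (Rsum_ext _ (fun _ => 0)), Rsum_const; [ring|].
    intros p Hp. rewrite Rsum_swap, (Rsum_ext _ (fun _ => 0)), Rsum_const;
      [ring|].
    intros q Hq. rewrite Rsum_swap, (Rsum_ext _ (fun _ => 0)), Rsum_const;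
      [ring|].
    intros i Hi. rewrite Rsum_swap, (Rsum_ext _ (fun _ => 0)), Rsum_const;
      [ring|].
    intros j Hj. apply sum_cos_grid.
    - apply s_range in Hp, Hq, Hi, Hj. unfold N. lia.
    - intros E. apply Hno. now exists i, j, p, q. }
  assert (Hlow : INR m ^ 4 - theta * (INR N * INR m) <= 0).
  { rewrite <- Hz.
    apply Rle_trans with (Rsum (fun x =>
      (if Nat.eq_dec x 0 then INR m ^ 4 else 0) +
      - theta * power s m (grid N x)) (seq 0 N)).
    - rewrite Rsum_plus, Rsum_scal.
      assert (INR m ^ 4 <=
        Rsum (fun x => if Nat.eq_dec x 0 then INR m ^ 4 else 0) (seq 0 N)).
      { apply (Rsum_ge_term
          (fun x => if Nat.eq_dec x 0 then INR m ^ 4 else 0) O).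
        - intros a _. destruct (Nat.eq_dec a 0); [|lra].
          apply pow_le, pos_INR.
        - apply in_seq. unfold N. nia. }
      pose proof sum_power_grid.
      assert (theta * Rsum (fun x => power s m (grid N x)) (seq 0 N) <=
        theta * (INR N * INR m)) by (apply Rmult_le_compat_l; lra).
      lra.
    - apply Rsum_le. intros x Hx.
      pose proof (power_nonneg s m (grid N x)) as Hp.
      destruct (Nat.eq_dec x 0) as [->|Hx0].
      + replace (grid N 0) with 0 by (unfold grid; simpl; field;
          rewrite INR_N; nra).
        rewrite power_0, Rmult_0_l, cos_0.
        assert (0 <= theta * INR m ^ 2).
        { apply Rmult_le_pos; [lra|]. apply pow2_ge_0. }
        replace ((INR m ^ 2) ^ 2) with (INR m ^ 4) by ring. lra.
      + destruct (Rle_dec (power s m (grid N x)) theta) as [Hle|Hgt].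
        * pose proof (COS_bound (grid N x * IZR k)). nra.
        * assert (0 <= cos (grid N x * IZR k)).
          { apply Hcos. apply large_spectrum_In. split; [exact Hx|lra]. }
          assert (0 <= power s m (grid N x) ^ 2 * cos (grid N x * IZR k)).
          { apply Rmult_le_pos; [apply pow2_ge_0|assumption]. }
          nra. }
  assert (E : theta * (INR N * INR m) = INR m ^ 4 / 2).
  { unfold theta. rewrite INR_N. field. lra. }
  assert (0 < INR m ^ 4) by (apply pow_lt; lra).
  lra.
Qed.

End FiniteBogolyubov.

Lemma bounded_sequences_subconverge (r : nat) (x : nat -> nat -> R) (B : R) :
  (forall j n, Rabs (x j n) <= B) ->
  exists (phi : nat -> nat) (l : nat -> R),
    (forall n, (n <= phi n)%nat) /\
    forall j, (j < r)%nat -> is_lim_seq (fun n => x j (phi n)) (l j).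
Proof.
  intros HB. induction r as [|r [phi [l [Hphi Hl]]]].
  - exists (fun n => n), (fun _ => 0). split; [auto|]. intros j Hj; lia.
  - destruct (Bolzano_Weierstrass (fun n => x r (phi n))
      (fun c => - B <= c <= B)) as [a Ha].
    { apply compact_P3. }
    { intros n. specialize (HB r (phi n)). apply Rabs_le_between in HB. lra. }
    assert (Hchi : forall n : nat, exists p, (n <= p)%nat /\
      Rabs (x r (phi p) - a) < / (INR n + 1)).
    { intros n. destruct (Ha (disc a (mkposreal _ (RinvN_pos n))) n)
        as [p [Hp1 Hp2]].
      - exists (mkposreal _ (RinvN_pos n)). intros y Hy. exact Hy.
      - exists p. split; [exact Hp1|]. exact Hp2. }
    destruct (choice _ Hchi) as [chi Hc].
    exists (fun n => phi (chi n)),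
      (fun j => if Nat.eq_dec j r then a else l j). split.
    + intros n. specialize (Hphi (chi n)). destruct (Hc n). lia.
    + intros j Hj. destruct (Nat.eq_dec j r) as [->|Hjr].
      * apply is_lim_seq_spec. intros eps.
        destruct (RinvN_cv (cond_pos eps)) as [N1 HN1].
        exists N1. intros n Hn. destruct (Hc n) as [_ H].
        specialize (HN1 n Hn). unfold R_dist in HN1.
        rewrite Rminus_0_r in HN1. simpl in HN1.
        apply Rle_lt_trans with (2 := HN1).
        apply Rle_trans with (2 := Rle_abs _). lra.
      * assert (Hj' : (j < r)%nat) by lia. specialize (Hl j Hj').
        apply (filterlim_comp _ _ _ chi (fun n => x j (phi n))
          eventually eventually); [|exact Hl].
        intros P [N0 HN0]. exists N0. intros n Hn. apply HN0.
        destruct (Hc n). lia.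
Qed.

(** The large spectra of the first [m] elements have a bounded number of
    elements, so they converge along a subsequence as [m] tends to infinity. The
    strict inequality at the limit frequencies gives the inequality needed at a
    late finite stage. *)
Theorem bogolyubov (s : nat -> Z) (L : nat) :
  (0 < L)%nat ->
  (forall i, (Z.of_nat (i * L) <= s i < Z.of_nat (i * L + L))%Z) ->
  exists (r : nat) (theta : nat -> R), forall k : Z,
    (forall j, (j < r)%nat -> 0 < cos (theta j * IZR k)) ->
    exists i j p q, (s i - s j + (s p - s q) + k = 0)%Z.
Proof.
  intros HL Hs.
  (* The spectra are listed and padded by the frequency 0. *)
  set (spec := fun n => map (grid (4 * (S n * L))) (large_spectrum s L (S n))).
  set (x := fun j n => nth j (spec n) 0).
  set (r := (32 * (L * L))%nat).
  destruct (bounded_sequences_subconverge r x (2 * PI)) as [phi [th [Hphi Hth]]].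
  { intros j n. unfold x. pose proof PI_RGT_0 as Hpi.
    destruct (nth_in_or_default j (spec n) 0) as [Hin| ->].
    2:{ rewrite Rabs_R0. lra. }
    apply in_map_iff in Hin as [y [<- Hy]].
    apply large_spectrum_In in Hy as [Hy _].
    apply in_seq in Hy.
    set (N := (4 * (S n * L))%nat) in *.
    assert (HN : 0 < INR N) by (apply lt_0_INR; lia).
    assert (Hq : 0 <= INR y / INR N <= 1).
    { pose proof (pos_INR y). assert (INR y <= INR N) by (apply le_INR; lia).
      split.
      - apply Rdiv_le_0_compat; lra.
      - apply (Rmult_le_reg_r (INR N)); [lra|]. unfold Rdiv.
        rewrite Rmult_assoc, Rinv_l; lra. }
    unfold grid. replace (2 * PI * INR y / INR N)
      with (2 * PI * (INR y / INR N)) by (field; lra).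
    rewrite Rabs_pos_eq; nra. }
  exists r, th. intros k Hk.
  assert (Hev : forall r', (r' <= r)%nat ->
    eventually (fun n => forall j, (j < r')%nat ->
      0 < cos (x j (phi n) * IZR k))).
  { induction r' as [|r' IH]; intros Hr'.
    - exists O. intros; lia.
    - assert (Hr : (r' < r)%nat) by lia.
      assert (Hlim : is_lim_seq (fun n => cos (x r' (phi n) * IZR k))
        (cos (th r' * IZR k))).
      { apply is_lim_seq_continuous.
        - apply continuity_pt_filterlim, continuous_cos.
        - apply (is_lim_seq_mult' (fun n => x r' (phi n)) (fun _ => IZR k)).
          + now apply Hth.
          + apply is_lim_seq_const. }
      assert (Hr1 : (r' <= r)%nat) by lia.
      destruct (IH Hr1) as [n1 Hn1].
      destruct (Hlim _ (open_gt 0 _ (Hk r' Hr))) as [n2 Hn2].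
      exists (n1 + n2)%nat. intros n Hn j Hj.
      destruct (Nat.eq_dec j r') as [->|].
      + apply Hn2. lia.
      + apply Hn1; lia. }
  destruct (Hev r (le_n _)) as [n0 Hn0].
  set (n := (n0 + Z.to_nat (Z.abs k))%nat).
  apply (finite_bogolyubov s L (S (phi n))); auto; try lia.
  - specialize (Hphi n). assert (n < S (phi n) * L)%nat by nia.
    unfold n in *. lia.
  - intros y Hy.
    assert (Hin : In (grid (4 * (S (phi n) * L)) y) (spec (phi n))).
    { now apply in_map. }
    destruct (In_nth _ _ 0 Hin) as [j [Hj E]].
    rewrite <- E. apply Rlt_le, (Hn0 n); [unfold n; lia|].
    unfold spec in Hj. rewrite length_map in Hj.
    pose proof (large_spectrum_length s L (S (phi n)) HL ltac:(lia) Hs).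
    unfold r. lia.
Qed.

(** * Almost periods and Bohr sets *)

Definition almost_period (f : R -> C) (eps tau : R) : Prop :=
  forall t : R, Cmod (f (t + tau)%R - f t) <= eps.

Lemma almost_period_plus f e1 e2 a b :
  almost_period f e1 a -> almost_period f e2 b ->
  almost_period f (e1 + e2) (a + b).
Proof.
  intros H1 H2 t.
  replace (f (t + (a + b))%R - f t)%C
    with ((f (t + b + a)%R - f (t + b)%R) + (f (t + b)%R - f t))%C.
  - apply Rle_trans with (1 := Cmod_triangle _ _).
    apply Rplus_le_compat; auto.
  - replace (t + (a + b)) with (t + b + a) by ring. ring.
Qed.

Lemma almost_period_opp f e a : almost_period f e a -> almost_period f e (- a).
Proof.
  intros H t. specialize (H (t + - a)).
  replace (t + - a + a) with t in H by ring.
  rewrite <- Cmod_opp.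
  now replace (- (f (t + - a)%R - f t))%C with (f t - f (t + - a)%R)%C by ring.
Qed.

Lemma almost_period_minus f e1 e2 a b :
  almost_period f e1 a -> almost_period f e2 b ->
  almost_period f (e1 + e2) (a - b).
Proof. intros H1 H2. apply almost_period_plus, almost_period_opp; auto. Qed.

(** An almost period moves any [t] into the compact interval [0, l], where the
    continuity of [f] is uniform; the next lemma uses the same idea. *)
Lemma almost_periodic_bounded f :
  almost_periodic f -> exists B, 0 < B /\ forall t, Cmod (f t) <= B.
Proof.
  intros [Hc Hap]. destruct (Hap 1 Rlt_0_1) as [l [Hl Hper]].
  destruct (bounded_continuity (f : R -> C_R_NormedModule) 0 l) as [M HM].
  { intros x _. apply Hc. }
  exists (Rmax M 0 + 1). split; [pose proof (Rmax_r M 0); lra|].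
  intros t. destruct (Hper (- t)) as [tau [Ht H]]. specialize (H t).
  assert (HM' : Cmod (f (t + tau)%R) < M).
  { rewrite Cmod_norm. apply HM. lra. }
  replace (f t) with (f (t + tau)%R + - (f (t + tau)%R - f t))%C by ring.
  apply Rle_trans with (1 := Cmod_triangle _ _). rewrite Cmod_opp.
  pose proof (Rmax_l M 0). lra.
Qed.

Lemma almost_periodic_unif_cont f eps :
  almost_periodic f -> 0 < eps ->
  exists d, 0 < d /\ forall s, Rabs s <= d -> almost_period f eps s.
Proof.
  intros [Hc Hap] Heps. destruct (Hap (eps / 3)) as [l [Hl Hper]]; [lra|].
  assert (He : 0 < eps / 3) by lra.
  destruct (unifcont_normed_1d (f : R -> C_R_NormedModule) (- 1) (l + 1)
    (fun x _ => Hc x) (mkposreal _ He)) as [[d Hd] Hu].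
  exists (Rmin (d / 2) 1). split; [apply Rmin_pos; lra|].
  intros s Hs t.
  assert (Hs1 := Rle_trans _ _ _ Hs (Rmin_l _ _)).
  assert (Hs2 := Rle_trans _ _ _ Hs (Rmin_r _ _)).
  apply Rabs_le_between in Hs2.
  destruct (Hper (- t)) as [tau [Ht H]].
  assert (H3 : Cmod (f (t + s + tau)%R - f (t + tau)%R) < eps / 3).
  { rewrite Cmod_norm. apply (Hu (t + tau) (t + s + tau)); try lra.
    simpl. unfold ball; simpl. unfold AbsRing_ball, abs, minus, plus, opp; simpl.
    replace (t + s + tau + - (t + tau)) with s by ring. lra. }
  assert (H1 := H t). assert (H2 := H (t + s)).
  replace (f (t + s)%R - f t)%C
    with (- (f (t + s + tau)%R - f (t + s)%R) +
          ((f (t + s + tau)%R - f (t + tau)%R) + (f (t + tau)%R - f t)))%C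
    by ring.
  apply Rle_trans with (1 := Cmod_triangle _ _). rewrite Cmod_opp.
  assert (H4 := Cmod_triangle (f (t + s + tau)%R - f (t + tau)%R)
    (f (t + tau)%R - f t)). lra.
Qed.

(** ** Trigonometric estimates *)

Lemma sin_abs_le x : Rabs (sin x) <= Rabs x.
Proof.
  assert (H : forall y, 0 < y -> Rabs (sin y) <= y).
  { intros y Hy. pose proof (sin_lt_x y Hy). apply Rabs_le. split; [|lra].
    destruct (Rle_dec y PI) as [Hp|Hp].
    - pose proof (sin_ge_0 y ltac:(lra) Hp). lra.
    - pose proof (SIN_bound y). pose proof PI2_1. lra. }
  destruct (Rtotal_order x 0) as [Hx|[->|Hx]].
  - rewrite <- (Rabs_Ropp x), <- (Rabs_Ropp (sin x)), <- sin_neg.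
    rewrite (Rabs_pos_eq (- x)) by lra. apply H. lra.
  - rewrite sin_0. lra.
  - rewrite (Rabs_pos_eq x) by lra. now apply H.
Qed.

Lemma cos_lipschitz x y : Rabs (cos x - cos y) <= Rabs (x - y).
Proof.
  rewrite form2, !Rabs_mult, (Rabs_left (-2)) by lra.
  pose proof (sin_abs_le ((x - y) / 2)).
  replace (Rabs ((x - y) / 2)) with (Rabs (x - y) / 2) in H.
  - assert (Rabs (sin ((x + y) / 2)) <= 1).
    { apply Rabs_le. apply SIN_bound. }
    pose proof (Rabs_pos (sin ((x - y) / 2))).
    pose proof (Rabs_pos (sin ((x + y) / 2))). nra.
  - unfold Rdiv. rewrite Rabs_mult, (Rabs_pos_eq (/ 2)); lra.
Qed.

Lemma cos_period_Z x (k : Z) : cos (x - 2 * PI * IZR k) = cos x.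
Proof.
  destruct (Z_le_gt_dec 0 k) as [H|H].
  - rewrite <- (cos_period (x - 2 * PI * IZR k) (Z.to_nat k)). f_equal.
    rewrite INR_IZR_INZ, Z2Nat.id by lia. ring.
  - rewrite <- (cos_period x (Z.to_nat (- k))). f_equal.
    rewrite INR_IZR_INZ, Z2Nat.id, opp_IZR by lia. ring.
Qed.

Lemma cos_near_1 eta : 0 < eta ->
  exists del, 0 < del <= 1 / 2 /\ forall y, 1 - del < cos y ->
    exists k : Z, Rabs (y - 2 * PI * IZR k) < eta.
Proof.
  intros Heta. pose proof PI_RGT_0 as Hpi.
  set (e := Rmin eta PI).
  assert (He : 0 < e) by now apply Rmin_pos.
  assert (He1 : e <= eta) by apply Rmin_l.
  assert (He2 : e <= PI) by apply Rmin_r.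
  assert (Hce : cos e < 1).
  { rewrite <- cos_0. apply cos_decreasing_1; lra. }
  exists (Rmin (1 / 2) (1 - cos e)). split.
  { split; [apply Rmin_pos; lra|apply Rmin_l]. }
  intros y Hy. assert (Hy' := Rmin_r (1 / 2) (1 - cos e)).
  exists (Int_part ((y + PI) / (2 * PI))).
  set (k := Int_part _). set (z := y - 2 * PI * IZR k).
  assert (Hz : - PI <= z <= PI).
  { destruct (base_Int_part ((y + PI) / (2 * PI))) as [H1 H2].
    fold k in H1, H2.
    assert (E : y = 2 * PI * ((y + PI) / (2 * PI)) - PI) by (field; lra).
    unfold z. split; nra. }
  assert (Hcz : cos z = cos y) by apply cos_period_Z.
  apply Rnot_le_lt. intros Hge.
  assert (Hcz' : cos (Rabs z) = cos z).
  { unfold Rabs. destruct (Rcase_abs z); [apply cos_neg|reflexivity]. }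
  assert (Rabs z <= PI) by now apply Rabs_le.
  assert (cos (Rabs z) <= cos e) by (apply cos_decr_1; lra).
  lra.
Qed.

(** ** Bohr sets *)

Definition bohr_set (Lam : list R) (del tau : R) : Prop :=
  forall lam, In lam Lam -> 1 - del < cos (lam * tau).

(** The multiples [k d] of a small step that are almost periods are
    syndetic; by Bogolyubov's theorem combinations of four of them contain a
    Bohr set of integers. The extra frequency [2 PI / d] forces a real number
    to be close to a multiple of [d], which brings the result to the line. *)
Theorem almost_periods_contain_bohr_set f eps :
  almost_periodic f -> 0 < eps ->
  exists Lam del, 0 < del /\
    forall tau, bohr_set Lam del tau -> almost_period f eps tau.
Proof.
  (* Four multiples of [d], each a [2 e]-almost period, and a remainder of size
     at most [d], an [e]-almost period. *)
  intros Hf Heps. set (e := eps / 9). assert (He : 0 < e) by (unfold e; lra).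
  destruct (almost_periodic_unif_cont f e Hf He) as [d [Hd Hu]].
  destruct Hf as [_ Hap]. destruct (Hap e He) as [l [Hl Hper]].
  set (L := S (Z.to_nat (up (l / d)))).
  assert (HL : l / d < INR L).
  { destruct (archimed (l / d)) as [H _].
    assert (0 < l / d) by (apply Rdiv_lt_0_compat; lra).
    assert (0 <= up (l / d))%Z by (apply le_IZR; lra).
    unfold L. rewrite S_INR, INR_IZR_INZ, Z2Nat.id by assumption. lra. }
  assert (Hs : forall i : nat, exists k : Z,
    (Z.of_nat (i * L) <= k < Z.of_nat (i * L + L))%Z /\
    almost_period f (e + e) (IZR k * d)).
  { intros i. destruct (Hper (INR (i * L) * d)) as [tau [Ht H]].
    destruct (base_Int_part (tau / d)) as [H1 H2].
    set (k := Int_part (tau / d)) in *. exists k.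
    assert (E : tau = (tau / d) * d) by (field; lra).
    assert (E' : l = (l / d) * d) by (field; lra).
    assert (Hq : INR (i * L) <= tau / d < INR (i * L + L)).
    { rewrite plus_INR. split.
      - apply (Rmult_le_reg_r d); [lra|]. lra.
      - apply (Rmult_lt_reg_r d); [lra|]. nra. }
    rewrite !INR_IZR_INZ in Hq. split.
    - split.
      + assert (IZR (Z.of_nat (i * L)) < IZR (k + 1)) by (rewrite plus_IZR; lra).
        apply lt_IZR in H0. lia.
      + apply lt_IZR. lra.
    - replace (IZR k * d) with (tau + (IZR k * d - tau)) by ring.
      apply almost_period_plus; [exact H|]. apply Hu. apply Rabs_le.
      split; nra. }
  destruct (choice _ Hs) as [s Hs'].
  assert (HL0 : (0 < L)%nat) by (unfold L; lia).
  destruct (bogolyubov s L HL0 (fun i => proj1 (Hs' i))) as [r [th Hth]].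
  (* [tau / d] has to be so close to an integer that multiplication by any
     [th j] leaves an error of at most 1/2 in the argument of the cosine. *)
  set (T := 1 + Rsum (fun j => Rabs (th j)) (seq 0 r)).
  assert (HT1 : 1 <= T).
  { unfold T. assert (0 <= Rsum (fun j => Rabs (th j)) (seq 0 r)); [|lra].
    apply Rsum_nonneg. intros a _. apply Rabs_pos. }
  assert (HT : forall j, (j < r)%nat -> Rabs (th j) <= T).
  { intros j Hj. unfold T.
    assert (Rabs (th j) <= Rsum (fun j => Rabs (th j)) (seq 0 r)); [|lra].
    apply (Rsum_ge_term (fun j => Rabs (th j))).
    - intros b _. apply Rabs_pos.
    - apply in_seq. lia. }
  destruct (cos_near_1 (/ T)) as [del [Hdel Hnear]].
  { apply Rinv_0_lt_compat. lra. }
  exists (2 * PI / d :: map (fun j => th j / d) (seq 0 r)), del.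
  split; [lra|]. intros tau Hb. pose proof PI2_3_2 as Hpi.
  destruct (Hnear (2 * PI / d * tau)) as [k Hk].
  { apply Hb. now left. }
  set (u := tau / d - IZR k).
  assert (Hu1 : Rabs u * (2 * PI) < / T).
  { rewrite <- (Rabs_pos_eq (2 * PI)) by lra. rewrite <- Rabs_mult.
    replace (u * (2 * PI)) with (2 * PI / d * tau - 2 * PI * IZR k);
      [exact Hk|]. unfold u. field. lra. }
  assert (HuT : Rabs u * T <= 1 / 2).
  { assert (Rabs u * (2 * PI) * T < 1).
    { replace 1 with (/ T * T) by (field; lra).
      apply Rmult_lt_compat_r; lra. }
    pose proof (Rabs_pos u). nra. }
  assert (Hud : Rabs u <= 1) by (pose proof (Rabs_pos u); nra).
  destruct (Hth k) as [i [j [p [q Hq]]]].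
  { intros j Hj.
    assert (H1 : 1 - del < cos (th j / d * tau)).
    { apply Hb. right. apply in_map_iff. exists j. split; [reflexivity|].
      apply in_seq. lia. }
    assert (H2 := cos_lipschitz (th j / d * tau) (th j * IZR k)).
    replace (th j / d * tau - th j * IZR k) with (th j * u) in H2
      by (unfold u; field; lra).
    rewrite Rabs_mult in H2. specialize (HT j Hj).
    assert (Rabs (th j) * Rabs u <= 1 / 2).
    { pose proof (Rabs_pos u). nra. }
    apply Rle_trans with (1 := Rle_abs _) in H2. lra. }
  replace tau with ((IZR (s j) * d - IZR (s i) * d +
    (IZR (s q) * d - IZR (s p) * d)) + u * d).
  - replace eps with ((e + e + (e + e) + (e + e + (e + e))) + e)
      by (unfold e; field).
    apply almost_period_plus.
    + apply almost_period_plus; apply almost_period_minus; apply Hs'.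
    + apply Hu. rewrite Rabs_mult, (Rabs_pos_eq d) by lra. nra.
  - assert (E : IZR k = - (IZR (s i) - IZR (s j) + (IZR (s p) - IZR (s q)))).
    { rewrite <- !minus_IZR, <- plus_IZR, <- opp_IZR. f_equal. lia. }
    unfold u. rewrite E. field. lra.
Qed.

(** * Complex sums and exponentials *)

Definition Csum {A : Type} (F : A -> C) (l : list A) : C :=
  fold_right (fun a s => (F a + s)%C) (RtoC 0) l.

Lemma Csum_ext {A : Type} (F G : A -> C) l :
  (forall a, In a l -> F a = G a) -> Csum F l = Csum G l.
Proof.
  induction l as [|a l IH]; simpl; intros H; [reflexivity|].
  rewrite H, IH; auto.
Qed.

Lemma Csum_plus {A : Type} (F G : A -> C) l :
  Csum (fun a => F a + G a)%C l = (Csum F l + Csum G l)%C.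
Proof. induction l as [|a l IH]; simpl; [ring|]. rewrite IH; ring. Qed.

Lemma Csum_minus {A : Type} (F G : A -> C) l :
  Csum (fun a => F a - G a)%C l = (Csum F l - Csum G l)%C.
Proof. induction l as [|a l IH]; simpl; [ring|]. rewrite IH; ring. Qed.

Lemma Csum_scal {A : Type} (c : C) (F : A -> C) l :
  Csum (fun a => c * F a)%C l = (c * Csum F l)%C.
Proof. induction l as [|a l IH]; simpl; [ring|]. rewrite IH; ring. Qed.

Lemma Csum_app {A : Type} (F : A -> C) l1 l2 :
  Csum F (l1 ++ l2) = (Csum F l1 + Csum F l2)%C.
Proof. induction l1 as [|a l IH]; simpl; [ring|]. rewrite IH; ring. Qed.

Lemma Csum_map {A B : Type} (h : A -> B) (F : B -> C) l :
  Csum F (map h l) = Csum (fun a => F (h a)) l.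
Proof. induction l as [|a l IH]; simpl; [reflexivity|]. now rewrite IH. Qed.

Lemma Cmod_Csum_le {A : Type} (F : A -> C) (G : A -> R) l :
  (forall a, In a l -> Cmod (F a) <= G a) -> Cmod (Csum F l) <= Rsum G l.
Proof.
  induction l as [|a l IH]; simpl; intros H; [rewrite Cmod_0; lra|].
  apply Rle_trans with (1 := Cmod_triangle _ _).
  apply Rplus_le_compat; auto.
Qed.

Lemma Cexpi_0 : Cexpi 0 = RtoC 1.
Proof. unfold Cexpi. now rewrite cos_0, sin_0. Qed.

Lemma Cexpi_plus x y : Cexpi (x + y) = (Cexpi x * Cexpi y)%C.
Proof.
  unfold Cexpi, Cmult; simpl. rewrite cos_plus, sin_plus. f_equal. ring.
Qed.

Lemma Cmod_Cexpi x : Cmod (Cexpi x) = 1.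
Proof.
  unfold Cmod, Cexpi; cbn [fst snd]. rewrite <- sqrt_1. f_equal.
  rewrite <- (sin2_cos2 x). unfold Rsqr. ring.
Qed.

Lemma Cexpi_pow x k : (Cexpi x ^ k)%C = Cexpi (INR k * x).
Proof.
  induction k as [|k IH].
  - now rewrite Rmult_0_l, Cexpi_0.
  - rewrite S_INR. simpl Cpow. rewrite IH, <- Cexpi_plus. f_equal. ring.
Qed.

(** * Means over symmetric intervals *)

Lemma continuous_C (F : R -> C) t :
  continuous (fun t => fst (F t)) t -> continuous (fun t => snd (F t)) t ->
  continuous F t.
Proof.
  intros H1 H2.
  apply (continuous_ext (fun t => (fst (F t), snd (F t)))).
  - intros x. now destruct (F x).
  - intros P [e He]. destruct (H1 (ball (fst (F t)) e)) as [e1 He1].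
    { now exists e. }
    destruct (H2 (ball (snd (F t)) e)) as [e2 He2].
    { now exists e. }
    exists (mkposreal _ (Rmin_pos _ _ (cond_pos e1) (cond_pos e2))).
    intros y Hy. apply He. split; simpl.
    + apply He1. apply ball_le with (2 := Hy). apply Rmin_l.
    + apply He2. apply ball_le with (2 := Hy). apply Rmin_r.
Qed.

Lemma continuous_C_fst (F : R -> C) t :
  continuous F t -> continuous (fun t => fst (F t)) t.
Proof.
  intros H. apply (continuous_comp F fst); [exact H|].
  apply continuous_fst.
Qed.

Lemma continuous_C_snd (F : R -> C) t :
  continuous F t -> continuous (fun t => snd (F t)) t.
Proof.
  intros H. apply (continuous_comp F snd); [exact H|].
  apply continuous_snd.
Qed.

Definition Ccont (F : R -> C) : Prop := forall t : R, continuous F t.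

Lemma Ccont_const c : Ccont (fun _ => c).
Proof. intros t. apply continuous_const. Qed.

Lemma Ccont_plus F G :
  Ccont F -> Ccont G -> Ccont (fun t => F t + G t)%C.
Proof.
  intros HF HG t. apply continuous_C; simpl.
  - apply (continuous_plus (fun t => fst (F t)) (fun t => fst (G t)));
      now apply continuous_C_fst.
  - apply (continuous_plus (fun t => snd (F t)) (fun t => snd (G t)));
      now apply continuous_C_snd.
Qed.

Lemma Ccont_mult F G :
  Ccont F -> Ccont G -> Ccont (fun t => F t * G t)%C.
Proof.
  intros HF HG t. apply continuous_C; simpl.
  - apply (continuous_minus (fun t => fst (F t) * fst (G t))
      (fun t => snd (F t) * snd (G t)));
    apply (continuous_mult (K := R_AbsRing));
    try apply continuous_C_fst; try apply continuous_C_snd; auto.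
  - apply (continuous_plus (fun t => fst (F t) * snd (G t))
      (fun t => snd (F t) * fst (G t)));
    apply (continuous_mult (K := R_AbsRing));
    try apply continuous_C_fst; try apply continuous_C_snd; auto.
Qed.

Lemma Ccont_ext F G : (forall t, F t = G t) -> Ccont F -> Ccont G.
Proof.
  intros E H t. apply (continuous_ext F); [exact E|apply H].
Qed.

Lemma Ccont_minus F G :
  Ccont F -> Ccont G -> Ccont (fun t => F t - G t)%C.
Proof.
  intros HF HG. apply (Ccont_ext (fun t => F t + - RtoC 1 * G t)%C).
  - intros t. ring.
  - apply Ccont_plus; [exact HF|].
    apply Ccont_mult; [apply Ccont_const|exact HG].
Qed.

Lemma continuous_affine (a b t : R) : continuous (fun t => a * t + b) t.
Proof.
  apply (continuous_plus (fun t => a * t) (fun _ => b)).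
  - apply (continuous_mult (K := R_AbsRing) (fun _ => a) (fun t => t)).
    + apply continuous_const.
    + apply continuous_id.
  - apply continuous_const.
Qed.

Lemma Ccont_Cexpi a b : Ccont (fun t => Cexpi (a * t + b)).
Proof.
  intros t. apply continuous_C; unfold Cexpi; simpl.
  - apply (continuous_comp (fun t => a * t + b) cos);
      [apply continuous_affine|apply continuous_cos].
  - apply (continuous_comp (fun t => a * t + b) sin);
      [apply continuous_affine|apply continuous_sin].
Qed.

Lemma Ccont_shift F a : Ccont F -> Ccont (fun t => F (a + t)%R).
Proof.
  intros H t. apply (continuous_comp (fun t => a + t) F); [|apply H].
  apply (continuous_ext (fun t => 1 * t + a)).
  - intros x. simpl. ring.
  - apply continuous_affine.
Qed.

Lemma Ccont_Csum {A : Type} (F : A -> R -> C) l :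
  (forall a, In a l -> Ccont (F a)) -> Ccont (fun t => Csum (fun a => F a t) l).
Proof.
  induction l as [|a l IH]; intros H.
  - apply (Ccont_const (RtoC 0)).
  - simpl. apply Ccont_plus; [apply H; now left|].
    apply IH. intros b Hb. apply H. now right.
Qed.

Notation CRInt := (RInt (V := C_R_CompleteNormedModule)).
Notation is_CRInt := (is_RInt (V := C_R_CompleteNormedModule)).

Lemma is_CRInt_cont F a b : Ccont F -> is_CRInt F a b (CRInt F a b).
Proof.
  intros H. apply RInt_correct. apply ex_RInt_continuous.
  intros z _. apply H.
Qed.

Lemma is_CRInt_scal (c : C) F a b l :
  is_CRInt F a b l -> is_CRInt (fun t => c * F t)%C a b (c * l)%C.
Proof.
  intros H.
  assert (H1 := is_RInt_fct_extend_fst (U := R_NormedModule)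
    (V := R_NormedModule) F a b l H).
  assert (H2 := is_RInt_fct_extend_snd (U := R_NormedModule)
    (V := R_NormedModule) F a b l H).
  apply (is_RInt_fct_extend_pair (U := R_NormedModule)
    (V := R_NormedModule) (fun t => c * F t)%C a b); simpl.
  - apply (is_RInt_minus (V := R_NormedModule) (fun t => fst c * fst (F t))
      (fun t => snd c * snd (F t))).
    + now apply (is_RInt_scal (V := R_NormedModule)).
    + now apply (is_RInt_scal (V := R_NormedModule)).
  - apply (is_RInt_plus (V := R_NormedModule) (fun t => fst c * snd (F t))
      (fun t => snd c * fst (F t))).
    + now apply (is_RInt_scal (V := R_NormedModule)).
    + now apply (is_RInt_scal (V := R_NormedModule)).
Qed.

Definition avg (T : R) (F : R -> C) : C :=
  (RtoC (/ (2 * T)) * CRInt F (- T) T)%C.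

Lemma avg_ext T F G : (forall t, F t = G t) -> avg T F = avg T G.
Proof.
  intros H. unfold avg. f_equal. apply RInt_ext. intros x _. apply H.
Qed.

Lemma avg_plus T F G :
  Ccont F -> Ccont G -> avg T (fun t => F t + G t)%C = (avg T F + avg T G)%C.
Proof.
  intros HF HG. unfold avg. rewrite <- Cmult_plus_distr_l. f_equal.
  apply is_RInt_unique.
  apply (is_RInt_plus (V := C_R_CompleteNormedModule) F G);
    now apply is_CRInt_cont.
Qed.

Lemma avg_scal T c F :
  Ccont F -> avg T (fun t => c * F t)%C = (c * avg T F)%C.
Proof.
  intros HF. unfold avg.
  rewrite (is_RInt_unique (V := C_R_CompleteNormedModule) _ _ _ _
    (is_CRInt_scal c F (- T) T _ (is_CRInt_cont F (- T) T HF))). ring.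
Qed.

Lemma avg_minus T F G :
  Ccont F -> Ccont G -> avg T (fun t => F t - G t)%C = (avg T F - avg T G)%C.
Proof.
  intros HF HG.
  rewrite (avg_ext T _ (fun t => F t + - RtoC 1 * G t)%C).
  - rewrite avg_plus, avg_scal; auto.
    + ring.
    + apply Ccont_mult; [apply Ccont_const|exact HG].
  - intros t. ring.
Qed.

Lemma avg_const T c : 0 < T -> avg T (fun _ => c) = c.
Proof.
  intros HT. unfold avg. rewrite RInt_const.
  assert (E : scal (V := C_R_CompleteNormedModule) (T - - T) c =
    (RtoC (2 * T) * c)%C).
  { replace (2 * T) with (T - - T) by ring.
    symmetry. unfold Cmult, RtoC, scal; simpl. unfold prod_scal, scal; simpl.
    unfold mult; simpl. f_equal; ring. }
  etransitivity; [apply f_equal; exact E|].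
  rewrite Cmult_assoc, <- RtoC_mult, Rinv_l, Cmult_1_l by lra. reflexivity.
Qed.

Lemma avg_Csum {A : Type} T (c : A -> C) (F : A -> R -> C) l :
  0 < T -> (forall a, In a l -> Ccont (F a)) ->
  avg T (fun t => Csum (fun a => c a * F a t)%C l) =
  Csum (fun a => c a * avg T (F a))%C l.
Proof.
  intros HT. induction l as [|a l IH]; intros H; simpl.
  - now rewrite avg_const.
  - rewrite avg_plus, avg_scal, IH; auto.
    + intros b Hb. apply H. now right.
    + apply H. now left.
    + apply Ccont_mult; [apply Ccont_const|apply H; now left].
    + apply (Ccont_Csum (fun a t => c a * F a t)%C). intros b Hb.
      apply Ccont_mult; [apply Ccont_const|apply H; now right].
Qed.

Lemma avg_bound T F B :
  0 < T -> Ccont F -> (forall t, Rabs t <= T -> Cmod (F t) <= B) ->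
  Cmod (avg T F) <= B.
Proof.
  intros HT HF HB. unfold avg.
  assert (H : Cmod (CRInt F (- T) T) <= (T - - T) * B).
  { rewrite Cmod_norm.
    apply (norm_RInt_le_const (V := C_R_NormedModule) F (- T) T); [lra| |].
    - intros x Hx. rewrite <- Cmod_norm. apply HB. now apply Rabs_le.
    - apply (is_CRInt_cont F (- T) T HF). }
  rewrite Cmod_mult, Cmod_R, Rabs_pos_eq.
  - apply (Rmult_le_reg_l (2 * T)); [lra|].
    rewrite <- Rmult_assoc, Rinv_r, Rmult_1_l by lra. lra.
  - apply Rlt_le, Rinv_0_lt_compat. lra.
Qed.

(** The two integration intervals differ by two intervals of length
    [|a|]. *)
Lemma avg_shift T F B a :
  0 < T -> Ccont F -> (forall t, Cmod (F t) <= B) ->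
  Cmod (avg T (fun s => F (a + s)%R) - avg T F) <= B * Rabs a / T.
Proof.
  intros HT HF HB. unfold avg.
  assert (Hex : forall u v, ex_RInt (V := C_R_CompleteNormedModule) F u v).
  { intros u v. eexists. now apply is_CRInt_cont. }
  assert (E : CRInt (fun s => F (a + s)%R) (- T) T =
              CRInt F (- T + a) (T + a)).
  { assert (H := RInt_comp_lin (V := C_R_CompleteNormedModule) F 1 a (- T) T
      (Hex _ _)).
    rewrite !Rmult_1_l in H.
    etransitivity; [|exact H]. apply RInt_ext. intros x _.
    transitivity (F (1 * x + a)); [f_equal; ring|]. symmetry.
    apply (scal_one (V := C_R_CompleteNormedModule)). }
  assert (E1 := RInt_Chasles (V := C_R_CompleteNormedModule) F
    (- T + a) (- T) (T + a) (Hex _ _) (Hex _ _)).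
  assert (E2 := RInt_Chasles (V := C_R_CompleteNormedModule) F
    (- T) T (T + a) (Hex _ _) (Hex _ _)).
  assert (Hb : forall u v, Cmod (CRInt F u v) <= Rabs (v - u) * B).
  { intros u v. rewrite Cmod_norm.
    apply (norm_RInt_le_const_abs (V := C_R_NormedModule) F u v).
    - intros x _. rewrite <- Cmod_norm. apply HB.
    - now apply (is_CRInt_cont F). }
  assert (D : (CRInt (fun s => F (a + s)%R) (- T) T - CRInt F (- T) T)%C =
    (CRInt F (- T + a) (- T) + CRInt F T (T + a))%C).
  { rewrite E.
    etransitivity; [apply (f_equal (fun z => (z - _)%C)); symmetry; exact E1|].
    rewrite <- E2.
    change (CRInt F (- T + a) (- T) + (CRInt F (- T) T + CRInt F T (T + a))
      - CRInt F (- T) T = CRInt F (- T + a) (- T) + CRInt F T (T + a))%C.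
    ring. }
  replace (RtoC (/ (2 * T)) * CRInt (fun s => F (a + s)%R) (- T) T -
    RtoC (/ (2 * T)) * CRInt F (- T) T)%C with
    (RtoC (/ (2 * T)) *
      (CRInt (fun s => F (a + s)%R) (- T) T - CRInt F (- T) T))%C by ring.
  rewrite D, Cmod_mult, Cmod_R, Rabs_pos_eq.
  2:{ apply Rlt_le, Rinv_0_lt_compat. lra. }
  assert (H := Cmod_triangle (CRInt F (- T + a) (- T)) (CRInt F T (T + a))).
  assert (H1 := Hb (- T + a) (- T)). assert (H2 := Hb T (T + a)).
  replace (- T - (- T + a)) with (- a) in H1 by ring. rewrite Rabs_Ropp in H1.
  replace (T + a - T) with a in H2 by ring.
  apply (Rmult_le_reg_l (2 * T)); [lra|].
  rewrite <- Rmult_assoc, Rinv_r, Rmult_1_l by lra.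
  replace (2 * T * (B * Rabs a / T)) with (2 * (Rabs a * B)) by (field; lra).
  lra.
Qed.

(** ** Limits of means *)

Definition tends (u : R -> C) (a : C) : Prop :=
  forall eps, 0 < eps ->
    exists T0, 0 < T0 /\ forall T, T0 <= T -> Cmod (u T - a) <= eps.

Lemma tends_ext u v a :
  (forall T, 0 < T -> u T = v T) -> tends u a -> tends v a.
Proof.
  intros E H eps He. destruct (H eps He) as [T0 [HT0 H0]].
  exists T0. split; [exact HT0|]. intros T HT. rewrite <- E; [auto|lra].
Qed.

Lemma tends_const a : tends (fun _ => a) a.
Proof.
  intros eps He. exists 1. split; [lra|]. intros T _.
  replace (a - a)%C with (RtoC 0) by ring. rewrite Cmod_0. lra.
Qed.

Lemma tends_plus u v a b :
  tends u a -> tends v b -> tends (fun T => u T + v T)%C (a + b)%C.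
Proof.
  intros Hu Hv eps He.
  destruct (Hu (eps / 2)) as [T1 [HT1 H1]]; [lra|].
  destruct (Hv (eps / 2)) as [T2 [HT2 H2]]; [lra|].
  exists (T1 + T2). split; [lra|]. intros T HT.
  specialize (H1 T ltac:(lra)). specialize (H2 T ltac:(lra)).
  replace (u T + v T - (a + b))%C with ((u T - a) + (v T - b))%C by ring.
  pose proof (Cmod_triangle (u T - a) (v T - b)). lra.
Qed.

Lemma tends_scal c u a : tends u a -> tends (fun T => c * u T)%C (c * a)%C.
Proof.
  intros Hu eps He. pose proof (Cmod_ge_0 c) as Hc.
  destruct (Hu (eps / (Cmod c + 1))) as [T1 [HT1 H1]].
  { apply Rdiv_lt_0_compat; lra. }
  exists T1. split; [lra|]. intros T HT. specialize (H1 T HT).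
  replace (c * u T - c * a)%C with (c * (u T - a))%C by ring.
  rewrite Cmod_mult.
  apply Rle_trans with ((Cmod c + 1) * (eps / (Cmod c + 1))).
  - apply Rmult_le_compat; [lra|apply Cmod_ge_0|lra|lra].
  - right. field. lra.
Qed.

Lemma tends_Csum {A : Type} (u : A -> R -> C) (a : A -> C) l :
  (forall x, In x l -> tends (u x) (a x)) ->
  tends (fun T => Csum (fun x => u x T) l) (Csum a l).
Proof.
  induction l as [|x l IH]; intros H; simpl.
  - apply tends_const.
  - apply tends_plus; [apply H; now left|].
    apply IH. intros y Hy. apply H. now right.
Qed.

Lemma tends_unique u a b : tends u a -> tends u b -> a = b.
Proof.
  intros Ha Hb. apply Ceq_minus, Cmod_eq_0.
  destruct (Rle_lt_or_eq_dec _ _ (Cmod_ge_0 (a - b))) as [H|H]; [|now rewrite H].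
  exfalso. destruct (Ha (Cmod (a - b) / 3)) as [T1 [_ H1]]; [lra|].
  destruct (Hb (Cmod (a - b) / 3)) as [T2 [_ H2]]; [lra|].
  set (T := Rmax T1 T2).
  specialize (H1 T (Rmax_l _ _)). specialize (H2 T (Rmax_r _ _)).
  assert (H3 := Cmod_triangle (- (u T - a)) (u T - b)).
  rewrite Cmod_opp in H3.
  replace (- (u T - a) + (u T - b))%C with (a - b)%C in H3 by ring. lra.
Qed.

Lemma avg_Cexpi_bound T mu nu :
  0 < T -> mu <> 0 ->
  Cmod (avg T (fun s => Cexpi (mu * s + nu))) <= / (Rabs mu * T).
Proof.
  intros HT Hmu. pose proof (Rabs_pos_lt _ Hmu) as Hmu'. unfold avg.
  set (P := fun s => (sin (mu * s + nu) / mu, - cos (mu * s + nu) / mu) : C).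
  assert (Hcont : Ccont (fun s => Cexpi (mu * s + nu))) by apply Ccont_Cexpi.
  assert (HI : is_CRInt (fun s => Cexpi (mu * s + nu)) (- T) T
    (P T - P (- T)%R)%C).
  { apply (is_RInt_fct_extend_pair (U := R_NormedModule)
      (V := R_NormedModule) (fun s => Cexpi (mu * s + nu))); simpl.
    - apply (is_RInt_derive (V := R_CompleteNormedModule)
        (fun s => sin (mu * s + nu) / mu)).
      + intros x _. auto_derive; [trivial|]. now field.
      + intros x _. apply (continuous_C_fst _ _ (Hcont x)).
    - apply (is_RInt_derive (V := R_CompleteNormedModule)
        (fun s => - cos (mu * s + nu) / mu)).
      + intros x _. auto_derive; [trivial|]. now field.
      + intros x _. apply (continuous_C_snd _ _ (Hcont x)). }
  rewrite (is_RInt_unique (V := C_R_CompleteNormedModule) _ _ _ _ HI).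
  assert (HP : forall s, Cmod (P s) = / Rabs mu).
  { intros s.
    replace (P s) with (RtoC (/ mu) * (- Ci * Cexpi (mu * s + nu)))%C.
    - rewrite !Cmod_mult, Cmod_opp, Cmod_Ci, Cmod_Cexpi, Cmod_R, Rabs_inv. ring.
    - unfold P, Cexpi, Ci, Cmult, Copp, RtoC; simpl. f_equal; field; auto. }
  assert (H := Cmod_triangle (P T) (- P (- T)%R)%C).
  rewrite Cmod_opp, !HP in H.
  rewrite Cmod_mult, Cmod_R, Rabs_pos_eq.
  2:{ apply Rlt_le, Rinv_0_lt_compat. lra. }
  apply (Rmult_le_reg_l (2 * T)); [lra|].
  rewrite <- Rmult_assoc, Rinv_r, Rmult_1_l by lra.
  replace (2 * T * / (Rabs mu * T)) with (/ Rabs mu + / Rabs mu)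
    by (field; lra). exact H.
Qed.

Lemma avg_Cexpi_tends mu nu :
  tends (fun T => avg T (fun s => Cexpi (mu * s + nu)))
    (if Req_EM_T mu 0 then Cexpi nu else RtoC 0).
Proof.
  destruct (Req_EM_T mu 0) as [->|Hmu].
  - apply tends_ext with (fun _ => Cexpi nu); [|apply tends_const].
    intros T HT. symmetry. rewrite <- (avg_const T (Cexpi nu) HT).
    apply avg_ext. intros t. f_equal. ring.
  - intros eps He. pose proof (Rabs_pos_lt _ Hmu) as Hmu'.
    exists (/ (Rabs mu * eps)).
    assert (Hp : 0 < / (Rabs mu * eps)).
    { apply Rinv_0_lt_compat. now apply Rmult_lt_0_compat. }
    split; [exact Hp|]. intros T HT.
    replace (avg T (fun s => Cexpi (mu * s + nu)) - RtoC 0)%C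
      with (avg T (fun s => Cexpi (mu * s + nu))) by ring.
    apply Rle_trans with (1 := avg_Cexpi_bound T mu nu ltac:(lra) Hmu).
    rewrite <- (Rinv_inv eps). apply Rinv_le_contravar.
    + now apply Rinv_0_lt_compat.
    + replace (/ eps) with (Rabs mu * / (Rabs mu * eps)) by (field; lra).
      apply Rmult_le_compat_l; lra.
Qed.

(** * Trigonometric polynomials with phases *)

(** [l] lists pairs of a coefficient and a frequency, and a frequency may occur
    several times, so that products need no collection of like terms. The phase
    of a term is a function of its frequency; additivity of [psi] keeps this form
    under multiplication. *)
Definition tpoly (psi : R -> R) (l : list (R * R)) (s : R) : C :=
  Csum (fun p => RtoC (fst p) * Cexpi (snd p * s - psi (snd p)))%C l.

Definition const_coeff (l : list (R * R)) : R :=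
  Rsum (fun p => if Req_EM_T (snd p) 0 then fst p else 0) l.

Definition tmul (l1 l2 : list (R * R)) : list (R * R) :=
  flat_map (fun p =>
    map (fun q => (fst p * fst q, snd p + snd q)) l2) l1.

Definition additive_on (V : R -> Prop) (psi : R -> R) : Prop :=
  V 0 /\ (forall x, V x -> V (- x)) /\
  forall x y, V x -> V y -> V (x + y) /\ psi (x + y) = psi x + psi y.

Definition positive_on (V : R -> Prop) (l : list (R * R)) : Prop :=
  forall p, In p l -> 0 <= fst p /\ V (snd p).

Lemma additive_on_0 V psi : additive_on V psi -> psi 0 = 0.
Proof.
  intros [H0 [_ H]]. destruct (H 0 0 H0 H0) as [_ E].
  rewrite Rplus_0_r in E. lra.
Qed.

Lemma additive_on_opp V psi x :
  additive_on V psi -> V x -> psi (- x) = - psi x.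
Proof.
  intros Ha Hx. pose proof (additive_on_0 V psi Ha) as E0.
  destruct Ha as [_ [Ho H]]. destruct (H x (- x) Hx (Ho x Hx)) as [_ E].
  rewrite Rplus_opp_r in E. lra.
Qed.

Lemma additive_on_INR V psi x k :
  additive_on V psi -> V x -> V (INR k * x) /\ psi (INR k * x) = INR k * psi x.
Proof.
  intros Ha Hx. pose proof (additive_on_0 V psi Ha) as E0.
  destruct Ha as [H0 [_ H]]. induction k as [|k [IH1 IH2]].
  - simpl. rewrite !Rmult_0_l. auto.
  - rewrite S_INR, !Rmult_plus_distr_r, !Rmult_1_l.
    destruct (H _ _ IH1 Hx) as [HV E]. split; [exact HV|]. lra.
Qed.

Lemma Ccont_tpoly psi l : Ccont (tpoly psi l).
Proof.
  unfold tpoly.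
  apply (Ccont_Csum (fun p s =>
    RtoC (fst p) * Cexpi (snd p * s - psi (snd p)))%C).
  intros p _. apply Ccont_mult; [apply Ccont_const|]. apply Ccont_Cexpi.
Qed.

Lemma avg_tpoly_tends psi l :
  psi 0 = 0 -> tends (fun T => avg T (tpoly psi l)) (RtoC (const_coeff l)).
Proof.
  intros H0.
  replace (RtoC (const_coeff l)) with (Csum (fun p => RtoC (fst p) *
    (if Req_EM_T (snd p) 0 then Cexpi (- psi (snd p)) else RtoC 0))%C l).
  - apply tends_ext with (fun T => Csum (fun p => RtoC (fst p) *
      avg T (fun s => Cexpi (snd p * s + - psi (snd p))))%C l).
    + intros T HT. rewrite <- avg_Csum; auto.
      intros p _. apply Ccont_Cexpi.
    + apply (tends_Csum (fun p T => RtoC (fst p) *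
        avg T (fun s => Cexpi (snd p * s + - psi (snd p))))%C).
      intros p _. apply tends_scal, avg_Cexpi_tends.
  - induction l as [|p l IH]; [reflexivity|].
    unfold const_coeff in *. simpl. rewrite IH, RtoC_plus. f_equal.
    destruct (Req_EM_T (snd p) 0) as [E|_]; [|ring].
    rewrite E, H0, Ropp_0, Cexpi_0. ring.
Qed.

Lemma tpoly_tmul V psi l1 l2 s :
  additive_on V psi -> positive_on V l1 -> positive_on V l2 ->
  tpoly psi (tmul l1 l2) s = (tpoly psi l1 s * tpoly psi l2 s)%C.
Proof.
  intros [_ [_ Ha]] H1 H2. unfold tpoly, tmul.
  induction l1 as [|p l1 IH]; simpl; [ring|].
  rewrite Csum_app, IH.
  2:{ intros q Hq. apply H1. now right. }
  rewrite Cmult_plus_distr_r. f_equal.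
  rewrite Csum_map, <- Csum_scal. apply Csum_ext. intros q Hq. simpl.
  destruct (H1 p (or_introl eq_refl)) as [_ Hp].
  destruct (H2 q Hq) as [_ Hq']. destruct (Ha _ _ Hp Hq') as [_ E].
  rewrite E, RtoC_mult.
  replace ((snd p + snd q) * s - (psi (snd p) + psi (snd q)))
    with ((snd p * s - psi (snd p)) + (snd q * s - psi (snd q))) by ring.
  rewrite Cexpi_plus. ring.
Qed.

Lemma positive_on_tmul V psi l1 l2 :
  additive_on V psi -> positive_on V l1 -> positive_on V l2 ->
  positive_on V (tmul l1 l2).
Proof.
  intros [_ [_ Ha]] H1 H2 p Hp. apply in_flat_map in Hp as [p1 [Hp1 Hp]].
  apply in_map_iff in Hp as [p2 [<- Hp2]]. simpl.
  destruct (H1 _ Hp1), (H2 _ Hp2). split.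
  - now apply Rmult_le_pos.
  - now apply Ha.
Qed.

(** The products of two constant terms contribute to the constant term, and
    no other contribution is negative. *)
Lemma const_coeff_tmul V l1 l2 :
  positive_on V l1 -> positive_on V l2 ->
  const_coeff l1 * const_coeff l2 <= const_coeff (tmul l1 l2).
Proof.
  intros H1 H2. unfold const_coeff, tmul.
  induction l1 as [|p l1 IH]; simpl; [lra|].
  rewrite Rsum_app, Rmult_plus_distr_r.
  apply Rplus_le_compat.
  2:{ apply IH. intros q Hq. apply H1. now right. }
  rewrite Rsum_map, <- Rsum_scal. apply Rsum_le. intros q Hq. simpl.
  destruct (H1 p (or_introl eq_refl)) as [Hp _].
  destruct (H2 q Hq) as [Hq' _].
  destruct (Req_EM_T (snd p) 0) as [E1|_];
  destruct (Req_EM_T (snd q) 0) as [E2|_];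
  destruct (Req_EM_T (snd p + snd q) 0) as [E|E]; nra.
Qed.

(** * The kernel *)

(** The binomial coefficient, extended by zero so that Pascal's rule has no
    boundary case. *)
Definition binom (n k : nat) : R := if (k <=? n)%nat then Binomial.C n k else 0.

Lemma binom_0 n : binom n 0 = 1.
Proof. unfold binom. simpl. unfold Binomial.C.
  rewrite Nat.sub_0_r. simpl. field. apply INR_fact_neq_0. Qed.

Lemma binom_S n k : binom (S n) (S k) = binom n k + binom n (S k).
Proof.
  unfold binom.
  destruct (Nat.leb_spec (S k) (S n)), (Nat.leb_spec k n),
    (Nat.leb_spec (S k) n); try lia; try lra.
  - now rewrite <- pascal by lia.
  - replace k with n by lia. unfold Binomial.C.
    rewrite !Nat.sub_diag. simpl (fact 0). simpl (INR 1).
    pose proof (INR_fact_neq_0 n). pose proof (INR_fact_neq_0 (S n)).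
    field. auto.
Qed.

Lemma binom_nonneg n k : 0 <= binom n k.
Proof.
  unfold binom. destruct (k <=? n)%nat; [|lra]. unfold Binomial.C.
  apply Rdiv_le_0_compat; [apply pos_INR|].
  apply Rmult_lt_0_compat; apply INR_fact_lt_0.
Qed.

Lemma Cbinomial (z : C) n :
  ((1 + z) ^ n)%C = Csum (fun k => RtoC (binom n k) * z ^ k)%C (seq 0 (S n)).
Proof.
  induction n as [|n IH].
  - simpl. rewrite binom_0. ring.
  - assert (E : forall f : nat -> C,
      Csum f (seq 0 (S (S n))) = (f O + Csum (fun k => f (S k)) (seq 0 (S n)))%C).
    { intros f. change (seq 0 (S (S n))) with (O :: seq 1 (S n)).
      rewrite <- seq_shift. simpl (Csum f (_ :: _)). now rewrite Csum_map. }
    rewrite E, binom_0.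
    rewrite (Csum_ext _ (fun k => z * (RtoC (binom n k) * z ^ k) +
      RtoC (binom n (S k)) * z ^ (S k))%C).
    2:{ intros k _. rewrite binom_S, RtoC_plus. simpl Cpow. ring. }
    rewrite Csum_plus, Csum_scal, <- IH.
    assert (E' := E (fun k => RtoC (binom n k) * z ^ k)%C). simpl in E'.
    rewrite binom_0 in E'.
    assert (L : Csum (fun k => RtoC (binom n k) * z ^ k)%C (seq 0 (S (S n))) =
      ((1 + z) ^ n)%C).
    { rewrite seq_S, Csum_app, <- IH. simpl.
      replace (binom n (S n)) with 0; [ring|].
      unfold binom. destruct (Nat.leb_spec (S n) n); [lia|reflexivity]. }
    rewrite E, binom_0 in L. simpl Cpow in *.
    transitivity (z * (1 + z) ^ n + (1 + z) ^ n)%C; [ring|].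
    rewrite <- L at 2. ring.
Qed.

(** Consecutive central binomial coefficients have the ratio
    [2 (2m + 1) / (m + 1)]. *)
Lemma central_binom m : 4 ^ m / (2 * INR m + 2) <= binom (2 * m) m.
Proof.
  assert (E : forall m, binom (2 * m) m = INR (fact (2 * m)) / INR (fact m) ^ 2).
  { intros n. unfold binom. destruct (Nat.leb_spec n (2 * n)); [|lia].
    unfold Binomial.C. replace (2 * n - n)%nat with n by lia.
    f_equal. ring. }
  induction m as [|m IH].
  - rewrite E. simpl. lra.
  - rewrite E in *. replace (2 * S m)%nat with (S (S (2 * m))) by lia.
    rewrite !fact_simpl, !mult_INR, !S_INR, mult_INR.
    set (F := INR (fact (2 * m))) in *. set (f := INR (fact m)) in *.
    assert (Hf : 0 < f) by apply INR_fact_lt_0.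
    set (x := INR m) in *. assert (Hx : 0 <= x) by apply pos_INR.
    simpl INR.
    replace (_ / ((x + 1) * f) ^ 2)
      with ((2 * (2 * x + 1) / (x + 1)) * (F / f ^ 2)) by (field; lra).
    apply Rle_trans with
      ((2 * (2 * x + 1) / (x + 1)) * (4 ^ m / (2 * x + 2))).
    + assert (Hp : 0 < 4 ^ m) by (apply pow_lt; lra). simpl pow.
      replace (4 * 4 ^ m / (2 * (x + 1) + 2))
        with (4 ^ m * (2 / (x + 2))) by (field; lra).
      replace (2 * (2 * x + 1) / (x + 1) * (4 ^ m / (2 * x + 2)))
        with (4 ^ m * ((2 * x + 1) / (x + 1) ^ 2)) by (field; lra).
      apply Rmult_le_compat_l; [lra|].
      apply (Rmult_le_reg_r ((x + 2) * (x + 1) ^ 2)); [nra|].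
      replace (2 / (x + 2) * ((x + 2) * (x + 1) ^ 2))
        with (2 * (x + 1) ^ 2) by (field; lra).
      replace ((2 * x + 1) / (x + 1) ^ 2 * ((x + 2) * (x + 1) ^ 2))
        with ((2 * x + 1) * (x + 2)) by (field; lra). nra.
    + apply Rmult_le_compat_l; [|exact IH].
      apply Rdiv_le_0_compat; lra.
Qed.

(** It peaks where every [lam * s] is close to [psi lam] modulo [2 PI]. *)
Definition kernel (psi : R -> R) (Lam : list R) (m : nat) (s : R) : R :=
  fold_right (fun lam x => ((1 + cos (lam * s - psi lam)) / 2) ^ m * x) 1 Lam.

(** As [(1 + cos x) / 2] is the square of [(e^(i x/2) + e^(- i x/2)) / 2], this is
    the binomial expansion of the power [2m] of the latter. *)
Lemma cos_factor_expansion x m :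
  RtoC (((1 + cos x) / 2) ^ m) =
  Csum (fun k => RtoC (binom (2 * m) k / 4 ^ m) *
                 Cexpi ((INR k - INR m) * x))%C (seq 0 (S (2 * m))).
Proof.
  assert (H4 : 0 < 4 ^ m) by (apply pow_lt; lra).
  rewrite (Csum_ext _ (fun k => RtoC (/ 4 ^ m) * Cexpi (- (INR m * x)) *
    (RtoC (binom (2 * m) k) * Cexpi x ^ k))%C).
  2:{ intros k _. unfold Rdiv. rewrite RtoC_mult, Cexpi_pow.
      replace ((INR k - INR m) * x) with (- (INR m * x) + INR k * x) by ring.
      rewrite Cexpi_plus. ring. }
  rewrite Csum_scal, <- Cbinomial, Cpow_mult_r.
  assert (E : ((1 + Cexpi x) ^ 2)%C =
    (RtoC 4 * (RtoC ((1 + cos x) / 2) * Cexpi x))%C).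
  { unfold Cexpi, Cmult, Cplus, RtoC. simpl Cpow.
    unfold Cmult; simpl. pose proof (sin2_cos2 x) as S. unfold Rsqr in S.
    f_equal; [|field].
    nra. }
  rewrite E, !Cpow_mult_l, Cexpi_pow, <- !RtoC_pow.
  transitivity (RtoC (/ 4 ^ m * 4 ^ m) * RtoC (((1 + cos x) / 2) ^ m) *
    (Cexpi (- (INR m * x)) * Cexpi (INR m * x)))%C.
  - rewrite <- Cexpi_plus, Rplus_opp_l, Cexpi_0, Rinv_l by lra. ring.
  - rewrite RtoC_mult. ring.
Qed.

(** Each factor [cos (x/2) ^ (2m)] has the constant term
    [binom (2m) m / 4 ^ m >= 1 / (2m + 2)]. Coefficients being nonnegative,
    constant terms are at least multiplicative ([const_coeff_tmul]), whatever
    relations hold between the frequencies. *)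
Lemma kernel_expansion V psi Lam m :
  additive_on V psi -> (forall lam, In lam Lam -> V lam) ->
  exists l, positive_on V l /\
    (forall s, tpoly psi l s = RtoC (kernel psi Lam m s)) /\
    (/ (2 * INR m + 2)) ^ length Lam <= const_coeff l.
Proof.
  intros Ha. pose proof (pos_INR m) as Hm.
  assert (Hm' : 0 < / (2 * INR m + 2)) by (apply Rinv_0_lt_compat; lra).
  induction Lam as [|lam Lam IH]; intros HV.
  - exists [(1, 0)]. split; [|split].
    + intros p [<-|[]]. simpl. split; [lra|]. apply Ha.
    + intros s. unfold tpoly. simpl.
      rewrite (additive_on_0 V psi Ha), Rmult_0_l, Rminus_0_r, Cexpi_0. ring.
    + unfold const_coeff. simpl. destruct (Req_EM_T 0 0); lra.
  - destruct IH as [l [Hl1 [Hl2 Hl3]]].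
    { intros x Hx. apply HV. now right. }
    assert (Hlam : V lam) by (apply HV; now left).
    set (h := fun k => (binom (2 * m) k / 4 ^ m, INR k * lam + - (INR m * lam))).
    assert (Hpsi : forall k, V (INR k * lam + - (INR m * lam)) /\
      psi (INR k * lam + - (INR m * lam)) = (INR k - INR m) * psi lam).
    { intros k. destruct (additive_on_INR V psi lam k Ha Hlam) as [A1 A2].
      destruct (additive_on_INR V psi lam m Ha Hlam) as [B1 B2].
      assert (O := additive_on_opp V psi _ Ha B1).
      destruct Ha as [_ [Ho Hp]]. destruct (Hp _ _ A1 (Ho _ B1)) as [HV' E].
      split; [exact HV'|]. rewrite E, O, A2, B2. ring. }
    assert (H4 : 0 < 4 ^ m) by (apply pow_lt; lra).
    assert (Hb : positive_on V (map h (seq 0 (S (2 * m))))).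
    { intros p Hp. apply in_map_iff in Hp as [k [<- _]]. simpl. split.
      - apply Rdiv_le_0_compat; [apply binom_nonneg|exact H4].
      - apply Hpsi. }
    exists (tmul (map h (seq 0 (S (2 * m)))) l). split; [|split].
    + eapply positive_on_tmul; eauto.
    + intros s. erewrite tpoly_tmul by eauto. rewrite Hl2. simpl kernel.
      rewrite RtoC_mult. f_equal. unfold tpoly. rewrite Csum_map.
      rewrite cos_factor_expansion. apply Csum_ext. intros k _.
      unfold h; cbn [fst snd]. destruct (Hpsi k) as [_ E]. rewrite E.
      f_equal. f_equal. ring.
    + apply Rle_trans with (2 := const_coeff_tmul V _ _ Hb Hl1).
      simpl pow. apply Rmult_le_compat; try lra.
      { apply pow_le. lra. }
      unfold const_coeff. rewrite Rsum_map.
      assert (Hin : In m (seq 0 (S (2 * m)))) by (apply in_seq; lia).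
      assert (Hh : forall k,
        0 <= (if Req_EM_T (snd (h k)) 0 then fst (h k) else 0)).
      { intros k. destruct (Req_EM_T _ _); [|lra]. simpl.
        apply Rdiv_le_0_compat; [apply binom_nonneg|exact H4]. }
      apply Rle_trans with (if Req_EM_T (snd (h m)) 0 then fst (h m) else 0).
      * destruct (Req_EM_T (snd (h m)) 0) as [_|n].
        2:{ exfalso. apply n. simpl. ring. }
        simpl. apply (Rmult_le_reg_r (4 ^ m)); [exact H4|].
        unfold Rdiv. rewrite Rmult_assoc, Rinv_l, Rmult_1_r by lra.
        rewrite Rmult_comm. apply central_binom.
      * apply (Rsum_ge_term
          (fun k => if Req_EM_T (snd (h k)) 0 then fst (h k) else 0));
          [intros k _; apply Hh|exact Hin].
Qed.

Lemma cos_factor_bounds x : 0 <= (1 + cos x) / 2 <= 1.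
Proof. pose proof (COS_bound x). lra. Qed.

Lemma pow_unit_interval x m : 0 <= x <= 1 -> 0 <= x ^ m <= 1.
Proof.
  intros H. split; [apply pow_le; lra|].
  rewrite <- (pow1 m). apply pow_incr. lra.
Qed.

Lemma kernel_bounds psi Lam m s : 0 <= kernel psi Lam m s <= 1.
Proof.
  induction Lam as [|lam Lam IH]; simpl; [lra|].
  pose proof (cos_factor_bounds (lam * s - psi lam)) as H.
  assert (0 <= ((1 + cos (lam * s - psi lam)) / 2) ^ m <= 1)
    by (apply pow_unit_interval; lra).
  split; [apply Rmult_le_pos; lra|]. nra.
Qed.

Lemma kernel_small psi Lam m s del lam :
  In lam Lam -> cos (lam * s - psi lam) <= 1 - del ->
  kernel psi Lam m s <= (1 - del / 2) ^ m.
Proof.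
  intros Hin Hc.
  assert (Hl : ((1 + cos (lam * s - psi lam)) / 2) ^ m <= (1 - del / 2) ^ m).
  { apply pow_incr. pose proof (cos_factor_bounds (lam * s - psi lam)). lra. }
  induction Lam as [|a Lam IH]; [contradiction|]. simpl.
  pose proof (kernel_bounds psi Lam m s) as Hk.
  pose proof (cos_factor_bounds (a * s - psi a)) as H.
  assert (0 <= ((1 + cos (a * s - psi a)) / 2) ^ m <= 1)
    by (apply pow_unit_interval; lra).
  destruct Hin as [->|Hin].
  - apply Rle_trans with (2 := Hl). nra.
  - specialize (IH Hin). nra.
Qed.

(** One power of the linear factor is absorbed by [sqrt rho ^ m], by Bernoulli's
    inequality, and the other [r] powers by the other [sqrt rho ^ m]. *)
Lemma poly_geom_bounded r rho : 0 < rho < 1 ->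
  exists B, 0 < B /\ forall m, (2 * INR m + 2) ^ r * rho ^ m <= B.
Proof.
  revert rho. induction r as [|r IH]; intros rho Hr.
  - exists 1. split; [lra|]. intros m. simpl. rewrite Rmult_1_l.
    apply pow_unit_interval. lra.
  - set (sg := sqrt rho).
    assert (E : sg * sg = rho) by (apply sqrt_sqrt; lra).
    assert (Hs0 : 0 < sg) by (apply sqrt_lt_R0; lra).
    assert (Hs : 0 < sg < 1) by nra.
    destruct (IH sg Hs) as [B [HB0 HB]].
    set (h := / sg - 1).
    assert (Hh : 0 < h).
    { unfold h. apply (Rmult_lt_reg_r sg); [lra|].
      rewrite Rmult_minus_distr_r, Rinv_l; lra. }
    exists ((2 / h + 2) * B).
    assert (Hh2 : 0 < 2 / h) by (apply Rdiv_lt_0_compat; lra).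
    split; [apply Rmult_lt_0_compat; lra|]. intros m.
    rewrite <- E, Rpow_mult_distr.
    replace ((2 * INR m + 2) ^ S r * (sg ^ m * sg ^ m))
      with (((2 * INR m + 2) * sg ^ m) * ((2 * INR m + 2) ^ r * sg ^ m))
      by (simpl; ring).
    pose proof (pos_INR m) as Hm.
    assert (Hsm : 0 < sg ^ m) by (apply pow_lt; lra).
    apply Rmult_le_compat; [nra| |
      |apply HB].
    { apply Rmult_le_pos; [apply pow_le; lra|lra]. }
    assert (P := poly m h Hh).
    replace (1 + h) with (/ sg) in P by (unfold h; ring).
    rewrite pow_inv in P.
    apply (Rmult_le_reg_r (/ sg ^ m)); [now apply Rinv_0_lt_compat|].
    rewrite Rmult_assoc, Rinv_r, Rmult_1_r by lra.
    apply Rle_trans with ((2 / h + 2) * (1 + INR m * h)).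
    + replace ((2 / h + 2) * (1 + INR m * h))
        with (2 / h + 2 * INR m + 2 + 2 * INR m * h) by (field; lra). nra.
    + apply Rmult_le_compat_l; lra.
Qed.

Lemma geom_beats_poly r rho eps : 0 < rho < 1 -> 0 < eps ->
  exists m, rho ^ m < eps * (/ (2 * INR m + 2)) ^ r.
Proof.
  intros Hr He. set (sg := sqrt rho).
  assert (E : sg * sg = rho) by (apply sqrt_sqrt; lra).
  assert (Hs0 : 0 < sg) by (apply sqrt_lt_R0; lra).
  assert (Hs : 0 < sg < 1) by nra.
  destruct (poly_geom_bounded r sg Hs) as [B [HB0 HB]].
  destruct (pow_lt_1_zero sg) with (y := eps / B) as [m Hm].
  { rewrite Rabs_pos_eq; lra. }
  { now apply Rdiv_lt_0_compat. }
  exists m. specialize (Hm m (le_n _)). specialize (HB m).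
  assert (Hsm : 0 < sg ^ m) by (apply pow_lt; lra).
  rewrite Rabs_pos_eq in Hm by lra.
  pose proof (pos_INR m).
  assert (Hp : 0 < (2 * INR m + 2) ^ r) by (apply pow_lt; lra).
  rewrite pow_inv, <- E, Rpow_mult_distr.
  apply (Rmult_lt_reg_r ((2 * INR m + 2) ^ r)); [exact Hp|].
  rewrite (Rmult_assoc eps), Rinv_l, Rmult_1_r by lra.
  apply Rle_lt_trans with (B * sg ^ m); [nra|].
  replace eps with (B * (eps / B)) by (field; lra).
  now apply Rmult_lt_compat_l.
Qed.

(** * Kronecker's theorem *)

(** If every [s] missed the target for some [lam], the kernel would be at most
    [(1 - d / 2) ^ m] everywhere, with [d] the minimum of [del] and [1], but its
    mean is at least [(2m + 2) ^ (- length Lam)]. *)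
Theorem kronecker V psi Lam del :
  additive_on V psi -> (forall lam, In lam Lam -> V lam) -> 0 < del ->
  exists s, forall lam, In lam Lam -> 1 - del < cos (lam * s - psi lam).
Proof.
  intros Ha HV Hdel. set (d := Rmin del 1).
  assert (Hd : 0 < d <= 1).
  { split; [apply Rmin_pos; lra|apply Rmin_r]. }
  assert (Hd' : d <= del) by apply Rmin_l.
  destruct (classic (exists s, forall lam, In lam Lam ->
    1 - del < cos (lam * s - psi lam))) as [H|Hno]; [exact H|exfalso].
  destruct (geom_beats_poly (length Lam) (1 - d / 2) 1) as [m Hm]; try lra.
  rewrite Rmult_1_l in Hm.
  destruct (kernel_expansion V psi Lam m Ha HV) as [l [_ [Hl Hc]]].
  set (rho := (1 - d / 2) ^ m) in *.
  assert (Hk : forall s, Cmod (tpoly psi l s) <= rho).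
  { intros s. rewrite Hl, Cmod_R, Rabs_pos_eq by apply kernel_bounds.
    apply NNPP. intros Hlt. apply Hno. exists s. intros lam Hin.
    apply Rnot_le_lt. intros Hle. apply Hlt.
    apply kernel_small with lam; [exact Hin|lra]. }
  destruct (avg_tpoly_tends psi l (additive_on_0 V psi Ha)
    ((const_coeff l - rho) / 2)) as [T [HT0 HT]]; [lra|].
  specialize (HT T (Rle_refl T)).
  assert (HB := avg_bound T (tpoly psi l) rho HT0 (Ccont_tpoly psi l)
    (fun t _ => Hk t)).
  assert (Htr := Cmod_triangle (avg T (tpoly psi l))
    (- (avg T (tpoly psi l) - RtoC (const_coeff l)))%C).
  rewrite Cmod_opp in Htr.
  replace (avg T (tpoly psi l) + - (avg T (tpoly psi l) - const_coeff l))%C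
    with (RtoC (const_coeff l)) in Htr by ring.
  rewrite Cmod_R in Htr. pose proof (Rle_abs (const_coeff l)). lra.
Qed.

(** * Approximation by trigonometric polynomials *)

Lemma avg_dominated T F G :
  0 < T -> Ccont F -> Ccont G -> (forall t, Cmod (F t) <= fst (G t)) ->
  Cmod (avg T F) <= Cmod (avg T G).
Proof.
  intros HT HF HG H.
  assert (Hi : 0 < / (2 * T)) by (apply Rinv_0_lt_compat; lra).
  unfold avg. rewrite !Cmod_mult. apply Rmult_le_compat_l; [apply Cmod_ge_0|].
  apply Rle_trans with (fst (CRInt G (- T) T)).
  - rewrite Cmod_norm.
    apply (norm_RInt_le (V := C_R_NormedModule) F (fun t => fst (G t)) (- T) T).
    + lra.
    + intros x _. rewrite <- Cmod_norm. apply H.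
    + now apply (is_CRInt_cont F).
    + apply (is_RInt_fct_extend_fst (U := R_NormedModule)
        (V := R_NormedModule) G). now apply (is_CRInt_cont G).
  - apply Rle_trans with (1 := Rle_abs _).
    apply Rle_trans with (2 := Rmax_Cmod _). apply Rmax_l.
Qed.

Definition twist (f : R -> C) (lam t : R) : C := (f t * Cexpi (- (lam * t)))%C.

Lemma fourier_mean_avg f lam T : fourier_mean f lam T = avg T (twist f lam).
Proof. reflexivity. Qed.

Lemma Ccont_twist f lam : Ccont f -> Ccont (twist f lam).
Proof.
  intros Hf. apply Ccont_mult; [exact Hf|].
  apply (Ccont_ext (fun t => Cexpi (- lam * t + 0))).
  - intros x. f_equal. ring.
  - apply Ccont_Cexpi.
Qed.

Lemma Cmod_twist f lam t : Cmod (twist f lam t) = Cmod (f t).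
Proof. unfold twist. rewrite Cmod_mult, Cmod_Cexpi. ring. Qed.

(** The convolution of [f] with an exponential of frequency [lam] is a multiple
    of that exponential. *)
Lemma twist_shift f lam t s :
  (Cexpi (lam * t) * twist f lam (t + s))%C =
  (f (t + s)%R * Cexpi (- (lam * s)))%C.
Proof.
  unfold twist.
  replace (- (lam * s)) with (lam * t + - (lam * (t + s))) by ring.
  rewrite (Cexpi_plus (lam * t)). ring.
Qed.

Lemma fourier_mean_bound f lam T B :
  0 < T -> Ccont f -> (forall t, Cmod (f t) <= B) ->
  Cmod (fourier_mean f lam T) <= B.
Proof.
  intros HT Hf HB. rewrite fourier_mean_avg. apply avg_bound; auto.
  - now apply Ccont_twist.
  - intros t _. rewrite Cmod_twist. apply HB.
Qed.

Lemma kernel_even Lam m s :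
  kernel (fun _ => 0) Lam m (- s) = kernel (fun _ => 0) Lam m s.
Proof.
  induction Lam as [|lam Lam IH]; simpl; [reflexivity|]. rewrite IH.
  replace (lam * - s - 0) with (- (lam * s - 0)) by ring.
  now rewrite cos_neg.
Qed.

Definition trig_sum (l : list (R * R)) (a : R -> C) (t : R) : C :=
  Csum (fun p => RtoC (fst p) * (Cexpi (snd p * t) * a (snd p)))%C l.

(** [f] is close to the normalized mean over [s] of [f (t + s) * K s], because off
    the Bohr set the kernel [K] is at most [eps / (2 B)] times its mean.
    The expansion of [K] turns this mean into a trigonometric sum. Replacing the
    mean of the translate by that of [f] costs [O(t / T)], which is why [t] is
    restricted to a bounded interval as long as [T] is finite. *)
Lemma trig_sum_approximation Lam del B eps :
  0 < del -> 0 < B -> 0 < eps ->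
  exists l : list (R * R), forall f : R -> C,
    Ccont f -> (forall t, Cmod (f t) <= B) ->
    (forall tau, bohr_set Lam del tau -> almost_period f eps tau) ->
    forall R0, exists T0, 0 < T0 /\ forall T t, T0 <= T -> Rabs t <= R0 ->
      Cmod (f t - trig_sum l (fun mu => fourier_mean f mu T) t) <= 3 * eps.
Proof.
  intros Hdel HB Heps. set (d := Rmin del 1).
  assert (Hd : 0 < d <= 1).
  { split; [apply Rmin_pos; lra|apply Rmin_r]. }
  assert (Hd' : d <= del) by apply Rmin_l.
  assert (HeB : 0 < eps / (2 * B)) by (apply Rdiv_lt_0_compat; lra).
  destruct (geom_beats_poly (length Lam) (1 - d / 2) (eps / (2 * B)))
    as [m Hm]; try lra.
  assert (Ha : additive_on (fun _ => True) (fun _ => 0)).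
  { repeat split; auto. lra. }
  destruct (kernel_expansion (fun _ => True) (fun _ => 0) Lam m Ha
    (fun _ _ => I)) as [l0 [Hpos [Hl Hc]]].
  set (K := kernel (fun _ => 0) Lam m) in *.
  set (kap := const_coeff l0) in *.
  set (rho := (1 - d / 2) ^ m) in *.
  assert (Hrho : 0 < rho) by (apply pow_lt; lra).
  assert (Hkap : 2 * B * rho <= eps * kap).
  { apply Rle_trans with (2 * B * (eps / (2 * B) * kap)).
    - apply Rmult_le_compat_l; [lra|].
      apply Rle_trans with (1 := Rlt_le _ _ Hm).
      apply Rmult_le_compat_l; lra.
    - right. field. lra. }
  assert (Hk0 : 0 < kap) by nra.
  set (l := map (fun p => (fst p / kap, snd p)) l0).
  exists l. intros f Hf Hfb Hper R0.
  (* both sides multiplied by the mean [kap] of the kernel *)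
  set (Z := fun T t => Csum (fun p =>
    RtoC (fst p) * (Cexpi (snd p * t) * fourier_mean f (snd p) T))%C l0).
  assert (EZ : forall T t, trig_sum l (fun mu => fourier_mean f mu T) t =
    (RtoC (/ kap) * Z T t)%C).
  { intros T t. unfold trig_sum, l, Z. rewrite Csum_map, <- Csum_scal.
    apply Csum_ext. intros p _. simpl. unfold Rdiv. rewrite RtoC_mult. ring. }
  set (S := Rsum (fun p => fst p) l0).
  assert (HS : 0 <= S) by (apply Rsum_nonneg; intros p Hp; now apply Hpos).
  (* [eta] and [T2] bound the error from the finite mean of the kernel and the
     error from the shift of the interval by [kap * eps / 2] each. *)
  set (eta := kap * eps / (2 * (B + eps))).
  assert (Heta : 0 < eta).
  { apply Rdiv_lt_0_compat; [apply Rmult_lt_0_compat|]; lra. }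
  destruct (avg_tpoly_tends (fun _ => 0) l0 eq_refl eta Heta)
    as [T1 [HT1 Havg]]. fold kap in Havg.
  assert (HR : 0 <= Rabs R0) by apply Rabs_pos.
  set (T2 := 2 * (S * B * Rabs R0) / (kap * eps)).
  assert (Hke : 0 < kap * eps) by now apply Rmult_lt_0_compat.
  assert (HT2 : 0 <= T2).
  { apply Rdiv_le_0_compat; [|exact Hke]. apply Rmult_le_pos; [lra|].
    apply Rmult_le_pos; [apply Rmult_le_pos; lra|lra]. }
  exists (T1 + T2). split; [lra|]. intros T t HT Ht.
  assert (HT0 : 0 < T) by lra.
  specialize (Havg T ltac:(lra)).
  set (aK := avg T (tpoly (fun _ => 0) l0)) in *.
  assert (HcK := Ccont_tpoly (fun _ => 0) l0).
  assert (Hsh := Ccont_shift f t Hf).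
  assert (HKC : forall s, tpoly (fun _ => 0) l0 s = RtoC (K s)) by exact Hl.
  set (D := fun s => ((f t - f (t + s)%R) * tpoly (fun _ => 0) l0 s)%C).
  assert (HcD : Ccont D).
  { apply Ccont_mult; [|exact HcK].
    apply Ccont_minus; [apply Ccont_const|exact Hsh]. }
  set (G := fun s => (RtoC eps * tpoly (fun _ => 0%R) l0 s + RtoC (2 * B * rho))%C).
  assert (HcG : Ccont (fun s => RtoC eps * tpoly (fun _ => 0%R) l0 s)%C).
  { apply Ccont_mult; [apply Ccont_const|exact HcK]. }
  (* On the Bohr set [f] hardly moves; off it the kernel is small. *)
  assert (HD : Cmod (avg T D) <= Cmod (avg T G)).
  { apply avg_dominated; auto.
    - apply Ccont_plus; [exact HcG|apply Ccont_const].
    - intros s. unfold D, G. rewrite HKC, Cmod_mult, Cmod_R. simpl.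
      pose proof (kernel_bounds (fun _ => 0) Lam m s) as HK01. fold K in HK01.
      rewrite Rabs_pos_eq by lra.
      assert (Hm1 : Cmod (f t - f (t + s)%R) <= 2 * B).
      { assert (H := Cmod_triangle (f t) (- f (t + s)%R)).
        rewrite Cmod_opp in H. assert (H1 := Hfb t).
        assert (H2 := Hfb (t + s)). unfold Cminus. lra. }
      pose proof (Cmod_ge_0 (f t - f (t + s)%R)) as Hm0.
      destruct (classic (bohr_set Lam del s)) as [Hb|Hb].
      + assert (H := Hper s Hb t).
        replace (f t - f (t + s)%R)%C with (- (f (t + s)%R - f t))%C in *
          by ring. rewrite Cmod_opp in *. nra.
      + apply not_all_ex_not in Hb as [lam Hb].
        apply imply_to_and in Hb as [Hin Hb].
        assert (K s <= rho).
        { apply (kernel_small _ _ _ _ _ lam Hin). rewrite Rminus_0_r. lra. }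
        nra. }
  assert (HG : Cmod (avg T G) <= eps * (kap + eta) + eps * kap).
  { unfold G. rewrite avg_plus, avg_scal, avg_const; auto.
    2:{ apply Ccont_const. }
    fold aK.
    assert (H := Cmod_triangle (RtoC eps * aK) (RtoC (2 * B * rho))).
    rewrite Cmod_mult, !Cmod_R, (Rabs_pos_eq eps) in H by lra.
    rewrite Rabs_pos_eq in H by nra.
    assert (H' := Cmod_triangle (aK - RtoC kap) (RtoC kap)).
    replace (aK - kap + kap)%C with aK in H' by ring.
    rewrite Cmod_R, (Rabs_pos_eq kap) in H' by lra.
    assert (eps * Cmod aK <= eps * (kap + eta)).
    { apply Rmult_le_compat_l; lra. }
    lra. }
  set (Y := Csum (fun p => RtoC (fst p) *
    (Cexpi (snd p * t) * avg T (fun s => twist f (snd p) (t + s)%R)))%C l0).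
  assert (EY : avg T D = (f t * aK - Y)%C).
  { unfold Y.
    rewrite (Csum_ext _ (fun p => (RtoC (fst p) * Cexpi (snd p * t)) *
      avg T (fun s => twist f (snd p) (t + s)%R))%C) by (intros; ring).
    assert (Htw : forall p, In p l0 ->
      Ccont (fun s => twist f (snd p) (t + s)%R)).
    { intros p _. apply (Ccont_shift (twist f (snd p)) t).
      now apply Ccont_twist. }
    rewrite <- (avg_Csum T (fun p => RtoC (fst p) * Cexpi (snd p * t))%C
      (fun p s => twist f (snd p) (t + s)%R) l0 HT0 Htw).
    unfold aK. rewrite <- avg_scal by exact HcK. rewrite <- avg_minus.
    - apply avg_ext. intros s. unfold D.
      replace ((f t - f (t + s)%R) * tpoly (fun _ => 0%R) l0 s)%C
        with (f t * tpoly (fun _ => 0%R) l0 s -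
              f (t + s)%R * tpoly (fun _ => 0%R) l0 s)%C by ring.
      f_equal.
      assert (E : tpoly (fun _ => 0) l0 s = tpoly (fun _ => 0) l0 (- s)).
      { rewrite !HKC. f_equal. symmetry. apply kernel_even. }
      rewrite E. unfold tpoly. rewrite <- Csum_scal.
      apply Csum_ext. intros p _.
      rewrite <- (Cmult_assoc (RtoC (fst p))), twist_shift.
      replace (snd p * - s - 0) with (- (snd p * s)) by ring. ring.
    - apply Ccont_mult; [apply Ccont_const|exact HcK].
    - apply (Ccont_Csum (fun p s => RtoC (fst p) * Cexpi (snd p * t) *
        twist f (snd p) (t + s)%R)%C). intros p Hp.
      apply Ccont_mult; [apply Ccont_const|now apply Htw]. }
  assert (HYZ : Cmod (Y - Z T t) <= S * B * Rabs R0 / T).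
  { unfold Y, Z. rewrite <- Csum_minus.
    apply Rle_trans with
      (Rsum (fun p => (B * Rabs R0 / T) * fst p) l0).
    - apply Cmod_Csum_le. intros p Hp.
      assert (H := avg_shift T (twist f (snd p)) B t HT0
        (Ccont_twist _ _ Hf)
        (fun u => Rle_trans _ _ _ (Req_le _ _ (Cmod_twist f (snd p) u)) (Hfb u))).
      rewrite <- fourier_mean_avg in H.
      set (u := avg T (fun s => twist f (snd p) (t + s)%R)) in *.
      replace (_ - _)%C with (RtoC (fst p) * (Cexpi (snd p * t) *
        (u - fourier_mean f (snd p) T)))%C by ring.
      rewrite !Cmod_mult, Cmod_Cexpi, Cmod_R, Rmult_1_l, Rmult_comm.
      destruct (Hpos p Hp) as [Hp0 _]. rewrite Rabs_pos_eq by exact Hp0.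
      apply Rmult_le_compat_r; [exact Hp0|].
      apply Rle_trans with (1 := H). unfold Rdiv.
      apply Rmult_le_compat_r; [apply Rlt_le, Rinv_0_lt_compat; lra|].
      apply Rmult_le_compat_l; [lra|].
      apply Rle_trans with (1 := Ht). apply Rle_abs.
    - rewrite Rsum_scal. change (Rsum fst l0) with S. right. field. lra. }
  assert (HST : S * B * Rabs R0 / T <= kap * eps / 2).
  { apply (Rmult_le_reg_r T); [lra|].
    replace (S * B * Rabs R0 / T * T) with (S * B * Rabs R0) by (field; lra).
    replace (S * B * Rabs R0) with (kap * eps / 2 * T2)
      by (unfold T2; field; lra).
    apply Rmult_le_compat_l; lra. }
  assert (Hfa : Cmod (f t * (RtoC kap - aK)) <= B * eta).
  { rewrite Cmod_mult. apply Rmult_le_compat; try apply Cmod_ge_0; auto.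
    rewrite <- Cmod_opp. now replace (- (kap - aK))%C with (aK - kap)%C by ring. }
  assert (HB2 : B * eta + eps * eta = kap * eps / 2).
  { unfold eta. field. lra. }
  assert (Hmain : Cmod (f t * RtoC kap - Z T t) <= 3 * eps * kap).
  { replace (f t * RtoC kap - Z T t)%C
      with (f t * (RtoC kap - aK) + (avg T D + (Y - Z T t)))%C
      by (rewrite EY; ring).
    assert (H1 := Cmod_triangle (f t * (RtoC kap - aK))
      (avg T D + (Y - Z T t))).
    assert (H2 := Cmod_triangle (avg T D) (Y - Z T t)). lra. }
  rewrite EZ.
  replace (f t - RtoC (/ kap) * Z T t)%C
    with (RtoC (/ kap) * (f t * RtoC kap - Z T t))%C.
  - rewrite Cmod_mult, Cmod_R, Rabs_pos_eq.
    + apply (Rmult_le_reg_l kap); [exact Hk0|].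
      rewrite <- Rmult_assoc, Rinv_r, Rmult_1_l by lra. lra.
    + apply Rlt_le, Rinv_0_lt_compat. lra.
  - transitivity ((RtoC (/ kap) * RtoC kap) * f t - RtoC (/ kap) * Z T t)%C;
      [ring|].
    rewrite <- RtoC_mult, Rinv_l by lra. ring.
Qed.

(** * Existence of the Fourier coefficients *)

Lemma Cmod_lt_ball (x y : C) eps : Cmod (y - x) < eps ->
  ball (M := C_UniformSpace) x eps y.
Proof. intros H. now apply C_NormedModule_mixin_compat1. Qed.

Lemma tends_filterlim u a : tends u a ->
  filterlim u (Rbar_locally p_infty)
    (locally (T := C_R_CompleteNormedModule) a).
Proof.
  intros H. apply filterlim_locally. intros eps.
  destruct (H (eps / 2)) as [T0 [_ H0]].
  { pose proof (cond_pos eps). lra. }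
  exists T0. intros T HT. apply (Cmod_lt_ball a (u T)).
  specialize (H0 T ltac:(lra)). pose proof (cond_pos eps). lra.
Qed.

Lemma tends_cauchy u :
  (forall eps, 0 < eps -> exists T0, forall T T', T0 <= T -> T0 <= T' ->
    Cmod (u T - u T') <= eps) ->
  exists a, tends u a.
Proof.
  intros H.
  destruct (proj1 (filterlim_locally_cauchy (U := C_R_CompleteNormedModule)
    (F := Rbar_locally p_infty) u)) as [a Ha].
  - intros eps. destruct (H (eps / 2)) as [T0 H0].
    { pose proof (cond_pos eps). lra. }
    exists (fun T => T0 < T). split; [now exists T0|].
    intros T T' HT HT'. apply (Cmod_lt_ball (u T) (u T')).
    specialize (H0 T' T ltac:(lra) ltac:(lra)).
    pose proof (cond_pos eps). lra.
  - exists a. intros eps Heps.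
    assert (Hs : 0 < sqrt 2) by (apply sqrt_lt_R0; lra).
    assert (He : 0 < eps / sqrt 2) by now apply Rdiv_lt_0_compat.
    destruct (proj1 (filterlim_locally (U := C_R_CompleteNormedModule)
      u a) Ha (mkposreal _ He)) as [T0 H0].
    exists (Rmax T0 0 + 1). split; [pose proof (Rmax_r T0 0); lra|].
    intros T HT. specialize (H0 T).
    assert (HT' : T0 < T) by (pose proof (Rmax_l T0 0); lra).
    apply H0 in HT'.
    apply (C_NormedModule_mixin_compat2 a (u T) (mkposreal _ He)) in HT'.
    simpl in HT'.
    replace (sqrt 2 * (eps / sqrt 2)) with eps in HT' by (field; lra).
    now apply Rlt_le.
Qed.

Lemma tends_uniform {A : Type} (u : A -> R -> C) (a : A -> C) l eps :
  (forall x, In x l -> tends (u x) (a x)) -> 0 < eps ->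
  exists T0, 0 < T0 /\ forall T x, T0 <= T -> In x l ->
    Cmod (u x T - a x) <= eps.
Proof.
  intros H He. induction l as [|x l IH].
  - exists 1. split; [lra|]. intros T x _ [].
  - destruct IH as [T1 [HT1 H1]].
    { intros y Hy. apply H. now right. }
    destruct (H x (or_introl eq_refl) eps He) as [T2 [HT2 H2]].
    exists (T1 + T2). split; [lra|]. intros T y HT [<-|Hy].
    + apply H2. lra.
    + apply H1; [lra|exact Hy].
Qed.

(** On [[- max T T', max T T']] the function [f] is close to a sum whose
    frequencies are fixed and whose coefficients, means of [f] over a much longer
    interval [- Ts, Ts], are bounded by [B]. The means of the finitely many
    exponentials converge, so those over [- T, T] and [- T', T'] agree for large
    [T] and [T'], uniformly in the choice of [Ts]. *)
Lemma fourier_mean_converges f lam :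
  almost_periodic f -> exists a, tends (fourier_mean f lam) a.
Proof.
  intros Hf. assert (Hc : Ccont f) by exact (proj1 Hf). apply tends_cauchy.
  intros eps Heps. set (e := eps / 8). assert (He : 0 < e) by (unfold e; lra).
  destruct (almost_periodic_bounded f Hf) as [B [HB HfB]].
  destruct (almost_periods_contain_bohr_set f e Hf He)
    as [Lam [del [Hdel Hper]]].
  destruct (trig_sum_approximation Lam del B e Hdel HB He) as [l Hl].
  specialize (Hl f Hc HfB Hper).
  set (E := fun (p : R * R) T => avg T (fun s => Cexpi ((snd p - lam) * s + 0))).
  set (S := Rsum (fun p => Rabs (fst p)) l).
  assert (HS : 0 <= S) by (apply Rsum_nonneg; intros; apply Rabs_pos).
  assert (Heta : 0 < e / (B * (S + 1))).
  { apply Rdiv_lt_0_compat; [lra|]. apply Rmult_lt_0_compat; lra. }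
  destruct (tends_uniform E
    (fun p => if Req_EM_T (snd p - lam) 0 then Cexpi 0 else RtoC 0) l
    (e / (B * (S + 1)))) as [T1 [HT1 HE]].
  { intros p _. apply avg_Cexpi_tends. }
  { exact Heta. }
  exists T1. intros T T' HT HT'.
  destruct (Hl (Rmax T T')) as [Ts [HTs Happ]].
  specialize (fun t => Happ Ts t (Rle_refl _)).
  set (dd := fun mu => fourier_mean f mu Ts) in *.
  assert (Hd : forall mu, Cmod (dd mu) <= B).
  { intros mu. now apply fourier_mean_bound. }
  set (Q := fun T => Csum (fun p => (RtoC (fst p) * dd (snd p)) * E p T)%C l).
  assert (Hclose : forall t, 0 < t -> t <= Rmax T T' ->
    Cmod (fourier_mean f lam t - Q t) <= 3 * e).
  { intros t Ht0 Ht. rewrite fourier_mean_avg. unfold Q, E.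
    assert (HcE : forall p : R * R, In p l ->
      Ccont (fun s => Cexpi ((snd p - lam) * s + 0))).
    { intros p _. apply Ccont_Cexpi. }
    assert (HcS : Ccont (fun s => Csum (fun p => (RtoC (fst p) * dd (snd p)) *
      Cexpi ((snd p - lam) * s + 0))%C l)).
    { apply (Ccont_Csum (fun p s => (RtoC (fst p) * dd (snd p)) *
        Cexpi ((snd p - lam) * s + 0))%C). intros p Hp.
      apply Ccont_mult; [apply Ccont_const|now apply HcE]. }
    rewrite <- (avg_Csum t (fun p => RtoC (fst p) * dd (snd p))%C _ l Ht0 HcE).
    rewrite <- avg_minus; auto using Ccont_twist.
    apply avg_bound; [exact Ht0| |].
    - apply Ccont_minus; [now apply Ccont_twist|exact HcS].
    - intros s Hs.
      replace (twist f lam s - _)%C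
        with (Cexpi (- (lam * s)) * (f s - trig_sum l dd s))%C.
      + rewrite Cmod_mult, Cmod_Cexpi, Rmult_1_l. apply Happ. lra.
      + unfold trig_sum, twist.
        transitivity (f s * Cexpi (- (lam * s)) - Cexpi (- (lam * s)) *
          Csum (fun p => RtoC (fst p) * (Cexpi (snd p * s) * dd (snd p))) l)%C;
          [ring|]. f_equal. rewrite <- Csum_scal.
        apply Csum_ext. intros p _.
        replace ((snd p - lam) * s + 0) with (- (lam * s) + snd p * s) by ring.
        rewrite Cexpi_plus. ring. }
  assert (HQ : Cmod (Q T - Q T') <= 2 * e).
  { unfold Q. rewrite <- Csum_minus.
    apply Rle_trans with (Rsum (fun p => 2 * (e / (S + 1)) * Rabs (fst p)) l).
    - apply Cmod_Csum_le. intros p Hp.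
      assert (H1 := HE T p HT Hp). assert (H2 := HE T' p HT' Hp).
      set (z := if Req_EM_T (snd p - lam) 0 then Cexpi 0 else RtoC 0) in *.
      replace (_ - _)%C with (RtoC (fst p) * dd (snd p) *
        ((E p T - z) + - (E p T' - z)))%C by ring.
      rewrite !Cmod_mult, Cmod_R.
      assert (H3 := Cmod_triangle (E p T - z) (- (E p T' - z))).
      rewrite Cmod_opp in H3.
      replace (2 * (e / (S + 1)) * Rabs (fst p)) with
        (Rabs (fst p) * B * (2 * (e / (B * (S + 1))))) by (field; lra).
      apply Rmult_le_compat; try apply Cmod_ge_0.
      + apply Rmult_le_pos; [apply Rabs_pos|apply Cmod_ge_0].
      + apply Rmult_le_compat_l; [apply Rabs_pos|apply Hd].
      + lra.
    - rewrite Rsum_scal. fold S.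
      apply (Rmult_le_reg_r (S + 1)); [lra|].
      replace (2 * (e / (S + 1)) * S * (S + 1)) with (2 * e * S)
        by (field; lra). nra. }
  assert (H1 := Hclose T ltac:(lra) (Rmax_l _ _)).
  assert (H2 := Hclose T' ltac:(lra) (Rmax_r _ _)).
  replace (fourier_mean f lam T - fourier_mean f lam T')%C with
    ((fourier_mean f lam T - Q T) +
     ((Q T - Q T') + - (fourier_mean f lam T' - Q T')))%C by ring.
  assert (H3 := Cmod_triangle (fourier_mean f lam T - Q T)
    ((Q T - Q T') + - (fourier_mean f lam T' - Q T'))).
  assert (H4 := Cmod_triangle (Q T - Q T')
    (- (fourier_mean f lam T' - Q T'))).
  rewrite Cmod_opp in H4. unfold e in *. lra.
Qed.

Lemma fourier_coeff_tends f lam :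
  almost_periodic f -> tends (fourier_mean f lam) (fourier_coeff f lam).
Proof.
  intros Hf. destruct (fourier_mean_converges f lam Hf) as [a Ha].
  replace (fourier_coeff f lam) with a; [exact Ha|].
  symmetry. unfold fourier_coeff.
  apply (iota_filterlim_locally (V := C_R_CompleteNormedModule)).
  now apply tends_filterlim.
Qed.

Lemma fourier_coeff_bound f lam B :
  almost_periodic f -> (forall t, Cmod (f t) <= B) ->
  Cmod (fourier_coeff f lam) <= B.
Proof.
  intros Hf HB. apply le_epsilon. intros eps He.
  destruct (fourier_coeff_tends f lam Hf eps He) as [T [HT H]].
  specialize (H T (Rle_refl T)).
  assert (H1 := fourier_mean_bound f lam T B HT (proj1 Hf) HB).
  assert (H2 := Cmod_triangle (fourier_mean f lam T)
    (- (fourier_mean f lam T - fourier_coeff f lam))).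
  rewrite Cmod_opp in H2.
  replace (fourier_mean f lam T + - (fourier_mean f lam T -
    fourier_coeff f lam))%C with (fourier_coeff f lam) in H2 by ring. lra.
Qed.

(** The limit [T -> oo] of [trig_sum_approximation], in which the restriction on
    [t] disappears. As the list [l] comes from the kernel of the Bohr set, it
    serves all functions with these almost periods. *)
Theorem fourier_approximation Lam del B eps :
  0 < del -> 0 < B -> 0 < eps ->
  exists l : list (R * R), forall f : R -> C,
    almost_periodic f -> (forall t, Cmod (f t) <= B) ->
    (forall tau, bohr_set Lam del tau -> almost_period f eps tau) ->
    forall t, Cmod (f t - trig_sum l (fourier_coeff f) t) <= 3 * eps.
Proof.
  intros Hdel HB He.
  destruct (trig_sum_approximation Lam del B eps Hdel HB He) as [l Hl].
  exists l. intros f Hf HfB Hper t. apply le_epsilon. intros eta Heta.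
  destruct (Hl f (proj1 Hf) HfB Hper (Rabs t)) as [T0 [HT0 H0]].
  destruct (tends_Csum (fun p T => RtoC (fst p) *
    (Cexpi (snd p * t) * fourier_mean f (snd p) T))%C
    (fun p => RtoC (fst p) * (Cexpi (snd p * t) *
      fourier_coeff f (snd p)))%C l) with (eps := eta) as [T1 [HT1 H1]];
    [|exact Heta|].
  { intros p _. apply tends_scal, tends_scal, (fourier_coeff_tends f _ Hf). }
  specialize (H1 (T0 + T1) ltac:(lra)).
  specialize (H0 (T0 + T1) t ltac:(lra) (Rle_refl _)).
  change (Cmod (trig_sum l (fun mu => fourier_mean f mu (T0 + T1)) t -
    trig_sum l (fourier_coeff f) t) <= eta) in H1.
  set (X := trig_sum l (fun mu => fourier_mean f mu (T0 + T1)) t) in *.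
  assert (H := Cmod_triangle (f t - X) (X - trig_sum l (fourier_coeff f) t)).
  replace (f t - X + (X - trig_sum l (fourier_coeff f) t))%C
    with (f t - trig_sum l (fourier_coeff f) t)%C in H by ring. lra.
Qed.

(** * Equivalent functions and their translates *)

Lemma Qspan_plus L n x y : Qspan L n x -> Qspan L n y -> Qspan L n (x + y).
Proof.
  intros [q1 ->] [q2 ->]. exists (fun j => (q1 j + q2 j)%Q).
  symmetry. etransitivity; [|apply (sum_n_m_plus (G := R_AbelianMonoid))].
  apply sum_n_m_ext. intros j. rewrite Q2R_plus.
  unfold plus; simpl. ring.
Qed.

Lemma Qspan_opp L n x : Qspan L n x -> Qspan L n (- x).
Proof.
  intros [q ->]. exists (fun j => (- q j)%Q).
  transitivity (-1 * sum_n_m (fun j => Q2R (q j) * expo L j) 1 n); [ring|].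
  symmetry. etransitivity;
    [|apply (sum_n_m_mult_l (K := R_Ring) (-1)
        (fun j => Q2R (q j) * expo L j))].
  apply sum_n_m_ext. intros j. rewrite Q2R_opp. unfold mult; simpl. ring.
Qed.

Lemma Q2R_0 : Q2R 0 = 0.
Proof. unfold Q2R. simpl. field. Qed.

Lemma Q2R_1 : Q2R 1 = 1.
Proof. unfold Q2R. simpl. field. Qed.

Lemma Qspan_0 L n : Qspan L n 0.
Proof.
  exists (fun _ => 0%Q). symmetry.
  etransitivity; [|apply (sum_n_m_const_zero (G := R_AbelianMonoid) 1 n)].
  apply sum_n_m_ext. intros j. rewrite Q2R_0. apply Rmult_0_l.
Qed.

Lemma Qspan_expo L n j : (1 <= j <= n)%nat -> Qspan L n (expo L j).
Proof.
  intros [H1 H2]. exists (fun k => if Nat.eq_dec k j then 1%Q else 0%Q).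
  set (u := fun k => Q2R (if Nat.eq_dec k j then 1%Q else 0%Q) * expo L k).
  assert (G : forall N, sum_n_m u 1 N = if le_dec j N then expo L j else 0).
  { induction N as [|N IH].
    - rewrite sum_n_m_zero by lia. destruct (le_dec j 0); [lia|reflexivity].
    - rewrite sum_n_Sm, IH by lia. unfold u at 1, plus; cbn -[Q2R Nat.eq_dec le_dec].
      destruct (Nat.eq_dec (S N) j) as [<-|Hne].
      + rewrite Q2R_1. destruct (le_dec (S N) N), (le_dec (S N) (S N));
          try lia. ring.
      + rewrite Q2R_0. destruct (le_dec j N), (le_dec j (S N)); try lia; ring. }
  rewrite G. destruct (le_dec j n); [reflexivity|lia].
Qed.

Lemma Qlinear_additive_on L n psi :
  Qlinear_on (Qspan L n) psi -> additive_on (Qspan L n) psi.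
Proof.
  intros [H _]. split; [apply Qspan_0|]. split; [apply Qspan_opp|].
  intros x y Hx Hy. split; [now apply Qspan_plus|now apply H].
Qed.

Lemma almost_periodic_translate f tau :
  almost_periodic f -> almost_periodic (fun t => f (t + tau)).
Proof.
  intros [Hc Hap]. split.
  - apply (Ccont_ext (fun t => f (tau + t)%R)).
    + intros t. f_equal. ring.
    + now apply Ccont_shift.
  - intros eps He. destruct (Hap eps He) as [l [Hl H]].
    exists l. split; [exact Hl|]. intros a. destruct (H a) as [s [Hs Ht]].
    exists s. split; [exact Hs|]. intros t. specialize (Ht (t + tau)).
    now replace (t + tau + s) with (t + s + tau) in Ht by ring.
Qed.

Lemma fourier_coeff_translate f tau lam :
  almost_periodic f ->
  fourier_coeff (fun t => f (t + tau)) lam =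
  (fourier_coeff f lam * Cexpi (lam * tau))%C.
Proof.
  intros Hf.
  apply (tends_unique (fourier_mean (fun t => f (t + tau)) lam)).
  { now apply fourier_coeff_tends, almost_periodic_translate. }
  destruct (almost_periodic_bounded f Hf) as [B [HB HfB]].
  set (d := fun T => (avg T (fun s => twist f lam (tau + s)%R) -
                      avg T (twist f lam))%C).
  assert (Hd : tends d (RtoC 0)).
  { intros eps He. exists (B * Rabs tau / eps + 1).
    assert (H0 : 0 <= B * Rabs tau / eps).
    { apply Rdiv_le_0_compat; [|exact He].
      apply Rmult_le_pos; [lra|apply Rabs_pos]. }
    split; [lra|]. intros T HT.
    replace (d T - RtoC 0)%C with (d T) by ring.
    apply Rle_trans with (B * Rabs tau / T).
    - apply avg_shift; [lra|apply Ccont_twist; exact (proj1 Hf)|].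
      intros t. rewrite Cmod_twist. apply HfB.
    - apply (Rmult_le_reg_r T); [lra|].
      replace (B * Rabs tau / T * T) with (eps * (B * Rabs tau / eps))
        by (field; lra).
      apply Rmult_le_compat_l; lra. }
  replace (fourier_coeff f lam * Cexpi (lam * tau))%C
    with (Cexpi (lam * tau) * (fourier_coeff f lam + RtoC 0))%C by ring.
  apply tends_ext with
    (fun T => Cexpi (lam * tau) * (fourier_mean f lam T + d T))%C.
  - intros T _. unfold d. rewrite !fourier_mean_avg.
    replace (avg T (twist f lam) + _)%C
      with (avg T (fun s => twist f lam (tau + s)%R)) by ring.
    rewrite <- avg_scal.
    + apply avg_ext. intros s. rewrite twist_shift. unfold twist.
      now rewrite (Rplus_comm tau s).
    + apply (Ccont_shift (twist f lam) tau), Ccont_twist; exact (proj1 Hf).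
  - apply tends_scal, tends_plus; [now apply fourier_coeff_tends|exact Hd].
Qed.

Lemma Qlinear_translate L n psi tau :
  Qlinear_on (Qspan L n) psi ->
  Qlinear_on (Qspan L n) (fun x => psi x + x * tau).
Proof.
  intros [H1 H2]. split.
  - intros x y Hx Hy. rewrite H1 by assumption. ring.
  - intros q x Hx. rewrite H2 by assumption. ring.
Qed.

Lemma ap_equiv_translate L h f tau :
  almost_periodic f -> ap_equiv L h f ->
  ap_equiv L h (fun t => f (t + tau)).
Proof.
  intros Hf H n Hn. destruct (H n Hn) as [psi [Hpsi Hj]].
  exists (fun x => psi x + x * tau).
  split; [now apply Qlinear_translate|]. intros j Hjn.
  rewrite fourier_coeff_translate, Hj, Cexpi_plus by assumption. ring.
Qed.

Lemma F_class_translate L f tau :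
  F_class L f -> F_class L (fun t => f (t + tau)).
Proof.
  intros [Hf H]. split; [now apply almost_periodic_translate|].
  intros lam Hlam. rewrite fourier_coeff_translate, H by assumption. ring.
Qed.

Lemma ap_equiv_common L h f g :
  ap_equiv L h f -> ap_equiv L h g -> ap_equiv L f g.
Proof.
  intros Hf Hg n Hn.
  destruct (Hf n Hn) as [p1 [[A1 B1] E1]], (Hg n Hn) as [p2 [[A2 B2] E2]].
  exists (fun x => p2 x - p1 x). split.
  - split.
    + intros x y Hx Hy. rewrite A1, A2 by assumption. ring.
    + intros q x Hx. rewrite B1, B2 by assumption. ring.
  - intros j Hj. rewrite E1, E2, <- Cmult_assoc, <- Cexpi_plus by assumption.
    f_equal. f_equal. ring.
Qed.

Lemma Cexpi_near x y del :
  1 - del < cos (x - y) -> Cmod (Cexpi x - Cexpi y) <= sqrt (2 * del).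
Proof.
  intros H.
  replace (Cexpi x - Cexpi y)%C with (Cexpi y * (Cexpi (x - y) - RtoC 1))%C.
  - rewrite Cmod_mult, Cmod_Cexpi, Rmult_1_l.
    unfold Cmod. apply sqrt_le_1_alt. simpl.
    pose proof (sin2_cos2 (x - y)) as S. unfold Rsqr in S. nra.
  - replace (Cexpi x) with (Cexpi (y + (x - y))) by (f_equal; ring).
    rewrite (Cexpi_plus y). ring.
Qed.

(** One index [n] beyond all exponents that occur lets one rational-linear map
    handle them together. The first case covers an empty set of exponents, for
    which there is no such index. *)
Lemma finite_frequency_range L (l : list (R * R)) :
  (forall p, In p l -> ~ in_exponents L (snd p)) \/
  exists n, index_in (expo_card L) n /\
    forall p, In p l -> in_exponents L (snd p) ->
      exists j, (1 <= j <= n)%nat /\ snd p = expo L j.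
Proof.
  induction l as [|p l IH].
  - left. intros p [].
  - destruct (classic (in_exponents L (snd p))) as [[j [Hj Ej]]|Hp].
    + right. destruct IH as [Hno|[n [Hn H]]].
      * exists j. split; [exact Hj|]. intros q [<-|Hq] Hin.
        -- exists j. split; [|exact Ej]. destruct Hj. lia.
        -- now destruct (Hno q Hq).
      * exists (Nat.max n j). split.
        { destruct (Nat.max_spec n j) as [[_ ->]|[_ ->]]; assumption. }
        intros q [<-|Hq] Hin.
        -- exists j. split; [|exact Ej]. destruct Hj. lia.
        -- destruct (H q Hq Hin) as [i [Hi E]]. exists i. split; [lia|exact E].
    + destruct IH as [Hno|[n [Hn H]]].
      * left. intros q [<-|Hq]; auto.
      * right. exists n. split; [exact Hn|]. intros q [<-|Hq] Hin; [tauto|auto].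
Qed.

(** Kronecker's theorem for the exponents in the list; at all other frequencies
    both coefficients vanish. *)
Lemma equivalent_coefficients_matched L f g (l : list (R * R)) eps :
  F_class L f -> F_class L g -> ap_equiv L f g -> 0 < eps ->
  exists tau, forall p, In p l ->
    Cmod (Cexpi (snd p * tau) * fourier_coeff f (snd p) -
          fourier_coeff g (snd p)) <= eps.
Proof.
  intros [Hf Hf0] [Hg Hg0] Heq He.
  assert (Hout : forall tau (p : R * R), ~ in_exponents L (snd p) ->
    Cmod (Cexpi (snd p * tau) * fourier_coeff f (snd p) -
          fourier_coeff g (snd p)) <= eps).
  { intros tau p Hp. rewrite Hf0, Hg0 by assumption.
    replace (_ - _)%C with (RtoC 0) by ring. rewrite Cmod_0. lra. }
  destruct (finite_frequency_range L l) as [Hno|[n [Hn H]]].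
  { exists 0. auto. }
  destruct (Heq n Hn) as [psi [Hpsi Hj]].
  destruct (almost_periodic_bounded f Hf) as [B [HB HfB]].
  assert (HeB : 0 < eps / B) by now apply Rdiv_lt_0_compat.
  destruct (kronecker (Qspan L n) psi (map (expo L) (seq 1 n))
    ((eps / B) ^ 2 / 2)) as [tau Htau].
  - now apply Qlinear_additive_on.
  - intros lam Hlam. apply in_map_iff in Hlam as [j [<- Hin]].
    apply Qspan_expo. apply in_seq in Hin. lia.
  - apply Rdiv_lt_0_compat; [now apply pow_lt|lra].
  - exists tau. intros p Hp.
    destruct (classic (in_exponents L (snd p))) as [Hin|Hin]; [|auto].
    destruct (H p Hp Hin) as [j [Hjn E]]. rewrite E, (Hj j Hjn).
    replace (_ - _)%C with (fourier_coeff f (expo L j) *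
      (Cexpi (expo L j * tau) - Cexpi (psi (expo L j))))%C by ring.
    rewrite Cmod_mult.
    replace eps with (B * (eps / B)) by (field; lra).
    apply Rmult_le_compat; try apply Cmod_ge_0.
    + now apply fourier_coeff_bound.
    + replace (eps / B) with (sqrt (2 * ((eps / B) ^ 2 / 2))).
      * apply Cexpi_near, Htau, in_map, in_seq. lia.
      * replace (2 * ((eps / B) ^ 2 / 2)) with ((eps / B) ^ 2) by (field; lra).
        apply sqrt_pow2. lra.
Qed.

Theorem equivalent_approximated_by_translates L f g eps :
  F_class L f -> F_class L g -> ap_equiv L f g -> 0 < eps ->
  exists tau, forall t, Cmod (f (t + tau)%R - g t) <= eps.
Proof.
  (* [3 e] for each of the two approximations and [e] between the sums. *)
  intros Hf Hg Heq Heps. set (e := eps / 7).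
  assert (He : 0 < e) by (unfold e; lra).
  destruct (almost_periodic_bounded f (proj1 Hf)) as [B1 [HB1 Hb1]].
  destruct (almost_periodic_bounded g (proj1 Hg)) as [B2 [HB2 Hb2]].
  destruct (almost_periods_contain_bohr_set f e (proj1 Hf) He)
    as [Lam1 [d1 [Hd1 Hp1]]].
  destruct (almost_periods_contain_bohr_set g e (proj1 Hg) He)
    as [Lam2 [d2 [Hd2 Hp2]]].
  assert (Hd : 0 < Rmin d1 d2) by now apply Rmin_pos.
  destruct (fourier_approximation (Lam1 ++ Lam2) (Rmin d1 d2) (B1 + B2) e Hd
    ltac:(lra) He) as [l Hl].
  assert (Hfl : forall t, Cmod (f t - trig_sum l (fourier_coeff f) t) <= 3 * e).
  { apply Hl; [apply Hf| |].
    - intros t. specialize (Hb1 t). lra.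
    - intros tau Htau. apply Hp1. intros lam Hlam.
      apply Rle_lt_trans with (1 - Rmin d1 d2).
      + pose proof (Rmin_l d1 d2). lra.
      + apply Htau, in_or_app. now left. }
  assert (Hgl : forall t, Cmod (g t - trig_sum l (fourier_coeff g) t) <= 3 * e).
  { apply Hl; [apply Hg| |].
    - intros t. specialize (Hb2 t). lra.
    - intros tau Htau. apply Hp2. intros lam Hlam.
      apply Rle_lt_trans with (1 - Rmin d1 d2).
      + pose proof (Rmin_r d1 d2). lra.
      + apply Htau, in_or_app. now right. }
  set (S := Rsum (fun p => Rabs (fst p)) l).
  assert (HS : 0 <= S) by (apply Rsum_nonneg; intros; apply Rabs_pos).
  assert (HeS : 0 < e / (S + 1)) by (apply Rdiv_lt_0_compat; lra).
  destruct (equivalent_coefficients_matched L f g l (e / (S + 1)) Hf Hg Heq HeS)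
    as [tau Htau].
  exists tau. intros t.
  assert (Hm : Cmod (trig_sum l (fourier_coeff f) (t + tau) -
    trig_sum l (fourier_coeff g) t) <= e).
  { unfold trig_sum. rewrite <- Csum_minus.
    apply Rle_trans with (Rsum (fun p => e / (S + 1) * Rabs (fst p)) l).
    - apply Cmod_Csum_le. intros p Hp.
      replace (_ - _)%C with (RtoC (fst p) * (Cexpi (snd p * t) *
        (Cexpi (snd p * tau) * fourier_coeff f (snd p) -
         fourier_coeff g (snd p))))%C.
      + rewrite !Cmod_mult, Cmod_R, Cmod_Cexpi, Rmult_1_l, Rmult_comm.
        apply Rmult_le_compat_r; [apply Rabs_pos|now apply Htau].
      + rewrite Rmult_plus_distr_l, Cexpi_plus. ring.
    - rewrite Rsum_scal. fold S. apply (Rmult_le_reg_r (S + 1)); [lra|].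
      replace (e / (S + 1) * S * (S + 1)) with (e * S) by (field; lra). nra. }
  specialize (Hfl (t + tau)). specialize (Hgl t).
  set (X := trig_sum l (fourier_coeff f) (t + tau)) in *.
  set (Y := trig_sum l (fourier_coeff g) t) in *.
  replace (f (t + tau)%R - g t)%C
    with ((f (t + tau)%R - X) + ((X - Y) + - (g t - Y)))%C by ring.
  assert (H1 := Cmod_triangle (f (t + tau)%R - X) ((X - Y) + - (g t - Y))).
  assert (H2 := Cmod_triangle (X - Y) (- (g t - Y))).
  rewrite Cmod_opp in H2. unfold e in *. lra.
Qed.

Theorem theorem2 (L : exponents) (G : (R -> C) -> Prop) (f : R -> C) :
  ap_equiv_class L G -> G f -> uniformly_dense_in (translates f) G.
Proof.
  intros [h [Hh HG]] Gf. destruct (proj1 (HG f) Gf) as [Ff Ef]. split.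
  - intros g [tau ->]. apply HG. split.
    + now apply F_class_translate.
    + apply ap_equiv_translate; [apply Ff|exact Ef].
  - intros g Gg U [eps HU]. destruct (proj1 (HG g) Gg) as [Fg Eg].
    pose proof (cond_pos eps) as Heps.
    destruct (equivalent_approximated_by_translates L f g (eps / 2) Ff Fg
      (ap_equiv_common L h f g Ef Eg)) as [tau Htau]; [lra|].
    exists (fun t => f (t + tau)). split; [now exists tau|].
    apply HU. intros t. apply (Cmod_lt_ball (g t) (f (t + tau))).
    specialize (Htau t). lra.
Qed.
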